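(* Let $q\ge 3$ be a prime power and let $G=\operatorname{AGL}(1,q)=\mathbb F_q\rtimes\mathbb F_q^\times$. Every normal Cayley connection set $S$ of $G$ for which $\operatorname{Cay}(G,S)$ is Ramanujan is of one of the five types (i)--(v) listed in the context, and the number of these types that occur is: (a) two if $q$ is even; (b) four if $q\equiv 1\pmod 4$; (c) five if $q\equiv 3\pmod 4$ and $q\ge 7$. For $q=3$ there are, up to isomorphism, exactly two distinct Ramanujan graphs $\operatorname{Cay}(G,S)$ with $S$ a normal Cayley connection set, namely $K_6$ and $K_{3,3}$.
   Context: Write $N=\mathbb F_q$ (the additive group, identified with the translation subgroup of $G$), $H=\mathbb F_q^\times$ acting on $N$ by multiplication, and $\pi:G\to H$, $\pi(nh)=h$, for the quotient map. A normal Cayley connection set of $G$ is an inverse-closed generating set $S\subset G\setminus\{1\}$ that is a union of conjugacy classes of $G$. $\operatorname{Cay}(G,S)$ is the graph with vertex set $G$ in which $x,y$ are adjacent iff $x^{-1}y\in S$. A connected $d$-regular graph is Ramanujan if every adjacency eigenvalue $\lambda$ with $|\lambda|\ne d$ satisfies $|\lambda|\le 2\sqrt{d-1}$ (so for a bipartite graph both $d$ and $-d$ are regarded as trivial). The five types of subsets $S\subset G\setminus\{1\}$ are: (i) $S=G\setminus\{1\}$; (ii) $S=G\setminus N$; (iii) $q\ge5$ and $S=(N\setminus\{1\})\cup\pi^{-1}(H\setminus\{1,z\})$, where $z\in Z(H)$ is an element of order two (here $1$ denotes the identity element of the respective group); (iv) $S=\pi^{-1}(H\setminus K)$, where $K\triangleleft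 H$ has index two; (v) $q\ge7$ and $S=\pi^{-1}((H\setminus K)\setminus\{z\})$, where $K\triangleleft H$ has index two and $z\in Z(H)\setminus K$ has order two. A type occurs if there is a normal Cayley connection set $S$ of $G$ of that form for which $\operatorname{Cay}(G,S)$ is Ramanujan; types whose descriptions give the same sets $S$ are counted only once. *)

(* Defs.v *)
From mathcomp Require Import all_boot all_order all_algebra all_fingroup.
From mathcomp Require Import all_solvable all_field.

Set Implicit Arguments.
Unset Strict Implicit.
Unset Printing Implicit Defensive.

Import Order.TTheory GRing.Theory Num.Theory.

(* A graph on a finite type is given by its adjacency relation. *)
Section Graphs.

Variable T : finType.
Implicit Type e : rel T.

Definition regular_graph e (d : nat) : Prop :=
  forall x, #|[set y | e x y]| = d.

Definition connected_graph e : Prop := forall x y, connect e x y.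

Definition adjacency_mx e : 'M[algC]_#|T| :=
  \matrix_(i, j) (e (enum_val i) (enum_val j))%:R%R.

(* As an integral matrix, [adjacency_mx e] has all its complex eigenvalues in
   [algC]. *)
Definition ramanujan e : Prop :=
  exists d : nat,
    [/\ connected_graph e, regular_graph e d
      & forall lam : algC, eigenvalue (adjacency_mx e) lam ->
          (`|lam| != d%:R -> `|lam| <= 2 * sqrtC (d%:R - 1))%R].

End Graphs.

Definition graph_iso (T U : finType) (e : rel T) (f : rel U) : Prop :=
  exists2 h : T -> U, bijective h & forall x y, f (h x) (h y) = e x y.

Definition complete_graph (n : nat) : rel 'I_n := fun x y => x != y.

Definition complete_bipartite (m n : nat) : rel ('I_m + 'I_n)%type :=
  fun x y => match x, y with
             | inl _, inr _ | inr _, inl _ => true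
             | _, _ => false
             end.

Section Cayley.

Variable gT : finGroupType.
Implicit Type S : {set gT}.

Definition cayley S : rel gT := fun x y => (x^-1 * y)%g \in S.

Definition normal_connection_set S : Prop :=
  [/\ S \subset [set: gT] :\ 1%g,
      {in S, forall x, x^-1%g \in S},
      <<S>>%g = [set: gT]
    & exists2 P : {set {set gT}}, P \subset classes [set: gT] & S = cover P].

End Cayley.

Section AGL1.

Variable F : finFieldType.

(* The additive group of F extended by {unit F} acting by multiplication; the
   pair (h, n) stands for the product h n of h in {unit F} and n in F. It is
   the affine map v |-> v * h + n, and products compose from left to right. *)
Definition AGL1 : finGroupType :=
  sdprod_groupType (FinRing.unit_groupAction F).

Definition translations : {set AGL1} :=
  (sdpair1 (FinRing.unit_groupAction F) @* [set: F])%g.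

Definition linear_part (x : AGL1) : {unit F} :=
  (pair_of_sd (x : sdprod_by (FinRing.unit_groupAction F))).1.

Inductive connection_type := TypeI | TypeII | TypeIII | TypeIV | TypeV.

Local Notation N := translations.
Local Notation H := [set: {unit F}].
Local Notation pi := linear_part.

Definition of_type (t : connection_type) (S : {set AGL1}) : bool :=
  match t with
  | TypeI => S == [set: AGL1] :\ 1%g
  | TypeII => S == [set: AGL1] :\: N
  | TypeIII =>
      (5 <= #|F|) &&
      [exists z : {unit F}, [&& z \in 'Z(H)%g, #[z]%g == 2 &
         S == (N :\ 1%g) :|: pi @^-1: (H :\: [set 1%g; z])]]
  | TypeIV =>
      [exists K : {group {unit F}}, [&& (K <| H)%g, #|H : K|%g == 2 &
         S == pi @^-1: (H :\: K)]]
  | TypeV =>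
      (7 <= #|F|) &&
      [exists K : {group {unit F}}, exists z : {unit F},
         [&& (K <| H)%g, #|H : K|%g == 2,
             z \in 'Z(H)%g :\: K, #[z]%g == 2 &
             S == pi @^-1: ((H :\: K) :\ z)]]
  end.

Definition type_sets (t : connection_type) : {set {set AGL1}} :=
  [set S | of_type t S].

Definition type_occurs (t : connection_type) : Prop :=
  exists S : {set AGL1},
    [/\ normal_connection_set S, of_type t S & ramanujan (cayley S)].

(* Types are counted through their collections [type_sets t], so that two types
   describing the same sets count once. *)
Definition num_types_occurring (n : nat) : Prop :=
  exists2 A : {set {set {set AGL1}}},
    forall C, C \in A <-> exists2 t, type_occurs t & C = type_sets t
  & #|A| = n.

End AGL1.

(* Main.v *)
Require Import Defs.
From mathcomp Require Import all_boot all_order all_algebra all_fingroup.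
From mathcomp Require Import all_solvable all_field.
From mathcomp Require Import all_character.
From mathcomp Require Import zify ring lra.
From HB Require Import structures.

(* A normal connection set of AGL(1,q) is determined by the set T of the
   nontrivial elements of its image in H = F_q^* and by whether it contains
   the nontrivial translations: it is S = pi^-1(T), or this set together
   with N \ {1} (the flag eps below). The spectrum of Cay(G,S) then consists
   of -eps (0 if eps is not set) and of the numbers eps(q-1) + q chi(T),
   where chi runs over the characters of H and chi(T) is the sum of the
   values of chi on T. So everything reduces to bounding character sums over
   the cyclic group H. Averaging |chi(T)|^2 over the characters shows that T
   is the complement, in H or in the nontrivial coset of an index two
   subgroup, of a set with very few elements. Most of the remaining small
   exceptions are excluded by weighting the average with |chi(C)|^2, where C
   is the complement of T, with 1 possibly removed (this gives a fourth
   moment), or by choosing a character with an explicit value; the delicate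
   case, T = H \ {1, a, a^-1} with all nontrivial translations in S, a of
   odd order generating H, needs a weight of Fejer type concentrated on the
   characters with chi(a) close to -1. *)

Set Implicit Arguments.
Unset Strict Implicit.
Unset Printing Implicit Defensive.

Import Order.TTheory GRing.Theory Num.Theory.

(** * Characters of finite abelian groups *)

Definition symmetric_set (gT : finGroupType) (A : {set gT}) :=
  {in A, forall x, x^-1%g \in A}.

Section AbelianCharacters.

Variable gT : finGroupType.
Hypothesis abT : abelian [set: gT].

Local Open Scope ring_scope.

Implicit Types (i : Iirr [set: gT]) (A B : {set gT}) (K : {group gT}).

Local Notation chi i := ('chi[[set: gT]]_i).

Definition char_sum i A : algC := \sum_(x in A) chi i x.

Let chi_lin i : chi i \is a linear_char.
Proof. exact: (char_abelianP _ abT). Qed.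

Lemma chiM i x y : chi i (x * y)%g = chi i x * chi i y.
Proof. by rewrite lin_charM ?inE. Qed.

Lemma chi1 i : chi i 1%g = 1.
Proof. by rewrite lin_char1. Qed.

Lemma chiV i x : chi i x^-1%g = (chi i x)^*.
Proof. by rewrite lin_charV_conj ?inE. Qed.

Lemma chiX i x m : chi i (x ^+ m)%g = chi i x ^+ m.
Proof. by rewrite lin_charX ?inE. Qed.

Lemma norm_chi i x : `|chi i x| = 1.
Proof. by rewrite normC_lin_char ?inE. Qed.

Lemma chiVr i x : chi i x * chi i x^-1%g = 1.
Proof. by rewrite -chiM mulgV chi1. Qed.

Lemma chi0 x : chi 0 x = 1.
Proof. by rewrite irr0 cfun1E inE. Qed.

Lemma sum_chi x : \sum_i chi i x = #|gT|%:R *+ (x == 1%g).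
Proof.
have := second_orthogonality_relation x (in_setT (1%g : gT)).
rewrite class1G inE; under eq_bigr do rewrite chi1 conjC1 mulr1.
by move->; case: eqP => // ->; rewrite cent11T setIT cardsT.
Qed.

Lemma sum_chi_ge0 x : 0 <= \sum_i chi i x.
Proof. by rewrite sum_chi mulrn_wge0 ?ler0n. Qed.

Lemma sum_chi_eq0 x : x != 1%g -> \sum_i chi i x = 0.
Proof. by rewrite sum_chi => /negPf->. Qed.

Lemma card_Iirr_ab : #|Iirr [set: gT]| = #|gT|.
Proof. by rewrite card_Iirr_abelian ?cardsT. Qed.

Lemma char_sum0 A : char_sum 0 A = #|A|%:R.
Proof.
by rewrite /char_sum (eq_bigr (fun _ => 1)) ?sumr_const // => x _; rewrite chi0.
Qed.

(** Translation by an element [x] with [chi i x != 1] multiplies the sum by [chi i x] but only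
    permutes its terms. *)
Lemma char_sumT i : i != 0 -> char_sum i [set: gT] = 0.
Proof.
move=> nz_i; have [x cx | c1] := pickP [pred x | chi i x != 1].
  apply/eqP; have /eqP: chi i x * char_sum i [set: gT] = char_sum i [set: gT].
    rewrite /char_sum mulr_sumr [RHS](reindex_inj (mulgI x)) /=.
    by apply: eq_big => [y|y _]; rewrite ?inE ?chiM.
  by rewrite -subr_eq0 -{2}[char_sum _ _]mul1r -mulrBl mulf_eq0 subr_eq0 (negPf cx).
case/eqP: nz_i; apply: irr_inj; apply/cfun_inP=> x _.
by rewrite chi0; apply/eqP; move/negbFE: (c1 x).
Qed.

Lemma char_sumD i A B : [disjoint A & B] ->
  char_sum i (A :|: B) = char_sum i A + char_sum i B.
Proof. by move=> dAB; rewrite /char_sum -bigU //=; apply: eq_bigl => x; rewrite !inE. Qed.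

Lemma char_sumC i A : i != 0 -> char_sum i (~: A) = - char_sum i A.
Proof.
move=> nz_i; have dA: [disjoint A & ~: A] by rewrite -setI_eq0 setICr.
by apply/eqP; rewrite -addr_eq0 addrC -char_sumD // setUCr char_sumT.
Qed.

Lemma char_sum_set1 i x : char_sum i [set x] = chi i x.
Proof. by rewrite /char_sum big_set1. Qed.

Lemma char_sum_real i A :
  symmetric_set A -> char_sum i A \is Num.real.
Proof.
move=> symA; apply/CrealP; rewrite /char_sum rmorph_sum /=.
rewrite [RHS](reindex_inj invg_inj) /=; apply: eq_big => [x|x _].
  by apply/idP/idP=> [/symA //|/symA]; rewrite invgK.
by rewrite -chiV.
Qed.

Lemma char_sum_sqr i A :
  symmetric_set A -> `|char_sum i A| ^+ 2 = char_sum i A ^+ 2.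
Proof. by move=> symA; rewrite real_normK // char_sum_real. Qed.

(** Coefficients on an indexed family, rather than on a set, cover both indicator functions
    ([parseval]) and the alternating sums over powers of [a] in [full_card_ne2]. *)
Lemma plancherel (I : finType) (c : I -> algC) (h : I -> gT) :
  \sum_i `|\sum_j c j * chi i (h j)| ^+ 2
    = #|gT|%:R * \sum_j \sum_k c j * (c k)^* *+ (h j == h k).
Proof.
under eq_bigr do rewrite normCK rmorph_sum mulr_suml.
rewrite exchange_big /= mulr_sumr; apply: eq_bigr => j _.
under eq_bigr do rewrite mulr_sumr.
rewrite exchange_big /= mulr_sumr; apply: eq_bigr => k _.
transitivity (c j * (c k)^* * \sum_i chi i (h j * (h k)^-1)%g).
  rewrite mulr_sumr; apply: eq_bigr => i _.
  by rewrite chiM chiV rmorphM /=; ring.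
by rewrite sum_chi -eq_mulgV1; case: eqP => _; rewrite ?mulr0 // mulr1n mulrC.
Qed.

Lemma parseval A : symmetric_set A ->
  \sum_i char_sum i A ^+ 2 = #|gT|%:R * #|A|%:R.
Proof.
move=> symA; under eq_bigr do rewrite -char_sum_sqr //.
transitivity (\sum_i `|\sum_x (x \in A)%:R * chi i x| ^+ 2).
  apply: eq_bigr => i _; congr (`|_| ^+ 2); rewrite /char_sum big_mkcond /=.
  by apply: eq_bigr => x _; rewrite mulr_natl mulrb.
rewrite (plancherel _ id); congr (_ * _); rewrite -sum1_card natr_sum [RHS]big_mkcond /=.
apply: eq_bigr => x _; rewrite (bigD1 x) //= eqxx big1 ?addr0 => [|y /negPf]; last first.
  by rewrite eq_sym => ->.
by case: (x \in A); rewrite ?mul0r // mul1r rmorph1.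
Qed.

(** Equality case of the triangle inequality for numbers of modulus 1. *)
Lemma char_sum_max i A : char_sum i A = #|A|%:R -> {in A, forall x, chi i x = 1}.
Proof.
move=> sumA; apply: (@normC_sum_upper _ _ _ (fun x => chi i x) (fun=> 1)).
  by move=> x _; rewrite norm_chi.
by rewrite sumr_const.
Qed.

Lemma char_sum_min i A :
  char_sum i A = - #|A|%:R -> {in A, forall x, chi i x = -1}.
Proof.
move=> sumA x Ax; apply: oppr_inj; rewrite opprK; move: x Ax.
apply: (@normC_sum_upper _ _ _ (fun x => - chi i x) (fun=> 1)).
  by move=> x _; rewrite normrN norm_chi.
by rewrite sumr_const sumrN -/(char_sum i A) sumA opprK.
Qed.

(** The points where two linear characters agree form a subgroup. *)
Lemma chi_eq_gen i j A : <<A>>%g = [set: gT] ->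
  {in A, forall x, chi i x = chi j x} -> i = j.
Proof.
move=> genA eqA; apply: irr_inj; apply/cfun_inP=> x _.
pose E := [set x | chi i x == chi j x].
have gE : group_set E.
  apply/group_setP; split=> [|y z]; rewrite !inE ?chi1 //.
  by rewrite !chiM => /eqP-> /eqP->.
have: <<A>>%g \subset Group gE.
  by rewrite gen_subG; apply/subsetP=> y Ay; rewrite inE eqA.
by rewrite genA => /subsetP/(_ x (in_setT x)); rewrite inE => /eqP.
Qed.

(** The quotient by [K] is a nontrivial abelian group, so it has a nontrivial character; this one is
    inflated. *)
Lemma exists_chi_ker K : K != [set: gT] :> {set gT} ->
  exists2 i, i != 0 & {in K, forall x, chi i x = 1}.
Proof.
move=> nKT; have nsK : (K <| [set: gT])%g by rewrite -sub_abelian_normal ?subsetT.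
have: (1 < #|Iirr ([set: gT] / K)|)%N.
  rewrite card_Iirr_abelian ?quotient_abelian // card_quotient ?normal_norm //.
  by rewrite indexg_gt1 subTset.
case/card_gt1P=> j [k [_ _ njk]].
have [l nz_l]: exists l : Iirr ([set: gT] / K), l != 0.
  by have [j0|] := eqVneq j 0; [exists k; rewrite -j0 eq_sym | exists j].
exists (mod_Iirr l); first by rewrite mod_Iirr_eq0.
move=> x Kx; rewrite cfker1 ?chi1 //.
by rewrite mod_IirrE //; apply: subsetP Kx; apply: cfker_mod.
Qed.

(** Spectral test for generation: a nontrivial character that is trivial on [<<A>>] would reach the
    maximal value [#|A|]. *)
Lemma gen_char_sum A :
  (forall i, i != 0 -> char_sum i A != #|A|%:R) -> <<A>>%g = [set: gT].
Proof.
move=> ntA; apply/eqP/idPn=> /exists_chi_ker[i nz_i kerA].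
case/eqP: (ntA i nz_i); rewrite /char_sum (eq_bigr (fun _ => 1)) ?sumr_const //.
by move=> x Ax; rewrite kerA ?mem_gen.
Qed.

End AbelianCharacters.

(** * Sets closed under inversion *)

Section SymmetricSets.

Variable gT : finGroupType.
Implicit Types (x y : gT) (A : {set gT}).

Local Open Scope group_scope.

Lemma order2E x : (#[x] == 2) = (x != 1) && (x == x^-1).
Proof.
apply/eqP/andP=> [x2 | [ntx /eqP xV]].
  by rewrite -order_eq1 x2 invg2id.
by apply: nt_prime_order => //; rewrite expgS expg1 {2}xV mulgV.
Qed.

Lemma symmetric_set2 A x : symmetric_set A -> #|A| = 2 -> x \in A ->
  x != x^-1 -> A = [set x; x^-1].
Proof.
move=> symA cA Ax nx; apply/esym/eqP; rewrite eqEcard cards2 nx cA leqnn andbT.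
by apply/subsetP=> y /set2P[]->; rewrite ?symA.
Qed.

Lemma symmetric_set1 A : symmetric_set A -> #|A| = 1%N ->
  exists2 x, x = x^-1 & A = [set x].
Proof.
move=> symA /eqP/cards1P[x defA]; exists x => //.
by have := symA x; rewrite defA !inE eqxx => /(_ isT)/eqP.
Qed.

Lemma symmetric_setD1 A x : symmetric_set A -> x = x^-1 -> symmetric_set (A :\ x).
Proof.
move=> symA xV y; rewrite !inE => /andP[nyx /symA->]; rewrite andbT.
by rewrite xV (inj_eq invg_inj).
Qed.

Lemma symmetric_setC A : symmetric_set A -> symmetric_set (~: A).
Proof. by move=> symA y; rewrite !inE; apply: contra => /symA; rewrite invgK. Qed.

End SymmetricSets.

(** * Power moments of character sums *)

Section Moments.

Variable gT : finGroupType.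
Hypothesis abT : abelian [set: gT].

Local Open Scope ring_scope.

Implicit Types (i : Iirr [set: gT]) (A T U : {set gT}) (K : {group gT}).

Local Notation chi i := ('chi[[set: gT]]_i).
Local Notation n := (#|gT|%:R : algC).

Lemma sum_nontrivial (f : Iirr [set: gT] -> algC) :
  \sum_(i | i != 0) f i = \sum_i f i - f 0.
Proof. by rewrite [in RHS](bigD1 0) //= addrAC subrr add0r. Qed.

(** An eigenvalue bound says that some polynomial in [X i] is nonnegative at each nontrivial
    character. Its sum is expressed here by the power moments of [X], minus the known contribution
    of the trivial character. *)
Lemma sum_poly4 (X : Iirr [set: gT] -> algC) c0 c1 c2 c3 c4 :
  \sum_(i | i != 0)
      (c0 + c1 * X i + c2 * X i ^+ 2 + c3 * X i ^+ 3 + c4 * X i ^+ 4)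
  = c0 * n + c1 * (\sum_i X i) + c2 * (\sum_i X i ^+ 2)
    + c3 * (\sum_i X i ^+ 3) + c4 * (\sum_i X i ^+ 4)
    - (c0 + c1 * X 0 + c2 * X 0 ^+ 2 + c3 * X 0 ^+ 3 + c4 * X 0 ^+ 4).
Proof.
rewrite sum_nontrivial !big_split /= -!mulr_sumr; congr (_ + _ + _ + _ + _ - _).
by rewrite sumr_const card_Iirr_ab // mulr_natr.
Qed.

Lemma sum_char_sum A : 1%g \notin A -> \sum_i char_sum i A = 0.
Proof.
move=> A'1; rewrite exchange_big big1 //= => x Ax.
by rewrite sum_chi_eq0 //; apply: contraNneq A'1 => <-.
Qed.

(* 19 is the number of quadruples from {e, a, a^-1} whose product is 1 in the
   generic case. *)
Lemma moments_triple (e a : gT) : (e * e = 1)%g -> (e != a)%g -> (e != a^-1)%g ->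
    a != a^-1%g ->
  let X i := char_sum i [set e; a; a^-1%g] in
  [/\ \sum_i X i ^+ 2 = n * 3, 0 <= \sum_i X i ^+ 3
    & n * 19 <= \sum_i X i ^+ 4].
Proof.
move=> ee nea neV naV X.
have eV : e = e^-1%g by apply/eqP; rewrite -mulg_eq1 ee.
have XE i : X i = chi i e + chi i a + chi i a^-1%g.
  rewrite /X !char_sumD ?char_sum_set1 //; rewrite -setI_eq0; apply/eqP/setP=> x.
    by rewrite !inE; case: eqP => // ->; rewrite (negPf nea).
  rewrite !inE; case: (x =P a^-1%g) => [->|]; rewrite ?andbF //.
  by rewrite ![a^-1%g == _]eq_sym (negPf neV) (negPf naV).
have chie i : chi i e ^+ 2 = 1 by rewrite expr2 -chiM // ee chi1.
have chia i := chiVr abT i a.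
split.
- rewrite parseval // => [|x]; last first.
    by rewrite !inE => /orP[/orP[]|] /eqP->; rewrite -?eV ?invgK eqxx ?orbT.
  congr (_ * _%:R); rewrite -setUA cardsU1 !inE negb_or nea neV.
  by rewrite cards2 naV.
- have -> : \sum_i X i ^+ 3 = \sum_i (7 * chi i e + 6 * chi i a + 6 * chi i a^-1
     + 3 * chi i (e * a * a) + 3 * chi i (e * a^-1 * a^-1)
     + chi i (a * a * a) + chi i (a^-1 * a^-1 * a^-1))%g.
    apply: eq_bigr => i _; rewrite XE !chiM //.
    move: (chie i) (chia i); set E := chi i e; set x := chi i a; set y := chi i _ => e2 xy.
    by ring: e2 xy.
  rewrite !big_split /= -!mulr_sumr.
  by do ![apply: addr_ge0]; rewrite ?mulr_ge0 ?sum_chi_ge0.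
rewrite -subr_ge0.
have -> : \sum_i X i ^+ 4 = \sum_i (19 + (16 * chi i (e * a) + 16 * chi i (e * a^-1)
     + 10 * chi i (a * a) + 10 * chi i (a^-1 * a^-1)
     + 4 * chi i (e * a * a * a) + 4 * chi i (e * a^-1 * a^-1 * a^-1)
     + chi i (a * a * a * a) + chi i (a^-1 * a^-1 * a^-1 * a^-1)))%g.
  apply: eq_bigr => i _; rewrite XE !chiM //.
  move: (chie i) (chia i); set E := chi i e; set x := chi i a; set y := chi i _ => e2 xy.
    by ring: e2 xy.
rewrite big_split sumr_const card_Iirr_ab // -[19 *+ _]mulr_natl addrC addKr.
rewrite !big_split /= -!mulr_sumr.
by do ![apply: addr_ge0]; rewrite ?mulr_ge0 ?sum_chi_ge0.
Qed.

End Moments.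

(** * Excluding small complements *)

(** Transfers the final numerical contradiction from [algC] to the integers, where [nia] applies. *)
Lemma int_lt0_contra (x : algC) (z : int) :
  (x = z%:~R -> z < 0 -> 0 <= x -> False)%R.
Proof. by move=> -> z_lt0; rewrite ler0z leNgt z_lt0. Qed.

Section EigenvalueBounds.

Variable gT : finGroupType.
Hypothesis abT : abelian [set: gT].

Local Open Scope ring_scope.

Implicit Types (i : Iirr [set: gT]) (A T U : {set gT}) (K : {group gT}).

Local Notation chi i := ('chi[[set: gT]]_i).
Local Notation n := (#|gT|%:R : algC).
Local Notation q := (#|gT|.+1%:R : algC).

Lemma char_sum_bounds T i : symmetric_set T ->
  - #|T|%:R <= char_sum i T <= #|T|%:R.
Proof.
move=> symT; rewrite -real_ler_norml ?char_sum_real //.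
apply: le_trans (ler_norm_sum _ _ _) _.
by rewrite (eq_bigr (fun _ => 1)) ?sumr_const // => x _; rewrite norm_chi.
Qed.

Lemma char_sum_ntriv T i : <<T>>%g = [set: gT] -> i != 0 ->
  char_sum i T != #|T|%:R.
Proof.
move=> genT; apply: contraNneq => /(char_sum_max abT) ker_i; apply/eqP.
by apply: (chi_eq_gen abT genT) => x /ker_i->; rewrite chi0.
Qed.

(** Second moment argument. Here [-(1 + q X)] is the eigenvalue and [U] the set of omitted
    nontrivial elements; summing the bound leaves the main term [- s q^2 (u - 4)], so [u > 4] is
    impossible, and the lower terms exclude [u = 4]. *)
Lemma full_card_le3 U : symmetric_set U -> 1%g \notin U -> (#|U|.+1 < #|gT|)%N ->
  (forall i, i != 0 ->
     (1 + q * char_sum i U) ^+ 2 <= 4 * (q ^+ 2 - q - 2 - q * #|U|%:R)) ->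
  (#|U| <= 3)%N.
Proof.
move=> symU U'1 properU boundU.
move: properU boundU; set u := #|U| => uP uB; rewrite leqNgt; apply/negP => u_gt3.
set B := 4 * _ in uB.
have : 0 <= \sum_(i | i != 0) ((B - 1) + (- (2 * q)) * char_sum i U
     + (- q ^+ 2) * char_sum i U ^+ 2 + 0 * char_sum i U ^+ 3
     + 0 * char_sum i U ^+ 4).
  apply: sumr_ge0 => i /uB; rewrite -subr_ge0; congr (0 <= _); ring.
rewrite sum_poly4 // sum_char_sum // parseval // char_sum0 -/u /B.
(* With [s] the number of elements outside [U], the bound [B] equals [4 (q s - 2)] and the sum
   factors conveniently. *)
have -> : #|gT| = (u + (#|gT| - u))%N by lia.
have : (2 <= #|gT| - u)%N by lia.
move: (#|gT| - u)%N => s s_ge2.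
apply: (@int_lt0_contra _ (let u := u%:Z in let s := s%:Z in let q := u + s + 1 in
   - (s * q ^+ 2 * (u - 4) + 8 * s * q - 2 * q * u + 9 * (q - 2)))).
  rewrite /= -addn1; ring.
nia.
Qed.

(** The plain second moment gives no contradiction for three elements. Weighting the bound by
    [X i ^+ 2] compares the main terms [12 q^2 n] and [19 q^2 n], the latter coming from the fourth
    moment. *)
Lemma full_card_ne3 (z a : gT) : z != 1%g -> (z * z = 1)%g -> z != a ->
  z != a^-1%g -> a != 1%g -> a != a^-1%g -> (5 < #|gT|)%N ->
  ~ (forall i, i != 0 ->
       (1 + q * char_sum i [set z; a; a^-1%g]) ^+ 2 <= 4 * (q ^+ 2 - 4 * q - 2)).
Proof.
move=> ntz zz nza nzaV nta naV n_gt5 boundU.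
have zV: z^-1%g = z by apply/eqP; rewrite eq_sym -mulg_eq1 zz.
have [M2 M3 M4] := moments_triple abT zz nza nzaV naV.
set X := (fun i => char_sum i [set z; a; a^-1%g]) in M2 M3 M4 boundU.
have M1 : \sum_i X i = 0.
  apply: sum_char_sum => //; rewrite !inE ![1%g == _]eq_sym invg_eq1.
  by rewrite (negPf ntz) (negPf nta).
have X0 : X 0 = 3.
  rewrite /X char_sum0 -setUA cardsU1 !inE negb_or nza nzaV.
  by rewrite cards2 naV.
set B := 4 * _ in boundU.
have : 0 <= \sum_(i | i != 0) (0 + 0 * X i + (B - 1) * X i ^+ 2
     + (- (2 * q)) * X i ^+ 3 + (- q ^+ 2) * X i ^+ 4).
  apply: sumr_ge0 => i /boundU; rewrite -subr_ge0 => Bi.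
  have -> : 0 + 0 * X i + (B - 1) * X i ^+ 2 + - (2 * q) * X i ^+ 3
     + - q ^+ 2 * X i ^+ 4 = X i ^+ 2 * (B - (1 + q * X i) ^+ 2) by ring.
  rewrite mulr_ge0 // real_exprn_even_ge0 // char_sum_real // => x.
  by rewrite !inE => /orP[/orP[]|] /eqP->; rewrite ?zV ?invgK ?eqxx ?orbT.
rewrite sum_poly4 // M1 M2 X0 => ge0.
have {ge0 M3 M4} : 0 <= (B - 1) * (n * 3 - 9) + 54 * q - q ^+ 2 * (19 * n - 81).
  apply: le_trans ge0 _; rewrite -subr_ge0.
  set m3 := \sum_i _ in M3 *; set m4 := \sum_i _ in M4 *.
  set D := _ - _; have -> : D = 2 * q * m3 + q ^+ 2 * (m4 - n * 19).
    by rewrite /D; ring.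
  by rewrite addr_ge0 // !mulr_ge0 ?exprn_ge0 ?subr_ge0.
apply: (@int_lt0_contra _ (let n := #|gT|%:Z in let q := n + 1 in
   (4 * (q ^+ 2 - 4 * q - 2) - 1) * (n * 3 - 9) + 54 * q - q ^+ 2 * (19 * n - 81))).
  rewrite /B /= -addn1; ring.
have -> : #|gT| = (6 + (#|gT| - 6))%N by lia.
nia.
Qed.

Lemma full_card_ne2 (a : gT) : a != a^-1%g -> (3 < #|gT|)%N ->
  ~ (forall i, i != 0 ->
       (1 + q * char_sum i [set a; a^-1%g]) ^+ 2 <= 4 * (q ^+ 2 - 3 * q - 2)).
Proof.
move=> naV n_gt3 boundU; have nta : a != 1%g by apply: contraNneq naV => ->; rewrite invg1.
have XE i : char_sum i [set a; a^-1%g] = chi i a + chi i a^-1%g.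
  rewrite char_sumD ?char_sum_set1 // -setI_eq0; apply/eqP/setP=> x.
  by rewrite !inE; case: eqP => // ->; rewrite (negPf naV).
(* If [a] does not generate, some nontrivial character has [chi i a = 1], and the sum 2 violates the
   bound. *)
have [genA | /exists_chi_ker] := eqVneq <[a]>%g [set: gT]; last first.
  case=> // i /boundU; rewrite XE chiV // => Bi /(_ a (cycle_id a)) chia.
  move: Bi; rewrite chia conjC1 -subr_ge0.
  apply: (@int_lt0_contra _ (let n := #|gT|%:Z in let q := n + 1 in
    4 * (q ^+ 2 - 3 * q - 2) - (1 + 2 * q) ^+ 2)); last by nia.
  rewrite /= -addn1; ring.
have chi_a1 i : chi i a = 1 -> i = 0.
  move=> chia; apply: (chi_eq_gen abT genA) => x; rewrite inE => /eqP->.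
  by rewrite chi0.
have oa : #[a]%g = #|gT| by rewrite orderE genA cardsT.
(* If the order of [a] is even, [a ^+ 2] generates a proper subgroup; a nontrivial character trivial
   on it has [chi i a = -1], and the sum -2 violates the bound. *)
have [odd_n | even_n] := boolP (odd #|gT|); last first.
  have : <[a ^+ 2]>%g != [set: gT].
    apply/eqP=> /(congr1 (fun A : {set gT} => #|A|)); rewrite cardsT -orderE.
    rewrite orderXdiv oa ?dvdn2 // => /eqP.
    by rewrite ltn_eqF // ltn_Pdiv // (leq_trans _ n_gt3).
  case/exists_chi_ker=> // i nzi /(_ _ (cycle_id _)); rewrite chiX // => chia2.
  have chia : chi i a = -1.
    move/eqP: chia2; rewrite sqrf_eq1 => /orP[] /eqP // /chi_a1 i0.
    by rewrite i0 eqxx in nzi.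
  have := boundU i nzi; rewrite XE chiV // chia -subr_ge0.
  apply: (@int_lt0_contra _ (let n := #|gT|%:Z in let q := n + 1 in
    4 * (q ^+ 2 - 3 * q - 2) - (1 - 2 * q) ^+ 2)); last by nia.
  rewrite /= rmorphN rmorph1 -addn1; ring.
(* The weight [|f i|^2], with [f i = 2 / (1 + chi i a)], is concentrated on the
   characters for which [chi i a] is close to -1. *)
pose f i := \sum_(j < #|gT|) (-1) ^+ j * chi i (a ^+ j)%g.
have fE i : f i * (1 + chi i a) = 2.
  have -> : f i = \sum_(j < #|gT|) (- chi i a) ^+ j.
    by apply: eq_bigr => j _; rewrite chiX // [RHS]exprNn.
  have := subrXX 1 (- chi i a) #|gT|.
  have -> : (- chi i a) ^+ #|gT| = -1.
    by rewrite exprNn -signr_odd odd_n -chiX // -oa expg_order chi1 // mulr1.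
  rewrite !opprK expr1n mulrC => E; rewrite -[RHS]/(1 + 1) E; congr (_ * _).
  by apply: eq_bigr => j _; rewrite expr1n mul1r.
have f2E i : `|f i| ^+ 2 * (2 + char_sum i [set a; a^-1%g]) = 4.
  have -> : 2 + char_sum i [set a; a^-1%g] = `|1 + chi i a| ^+ 2.
    rewrite normCK XE rmorphD rmorph1 /= -chiV //.
    by have := chiVr abT i a; set x := chi i a; set y := chi i _ => xy; ring: xy.
  by rewrite -exprMn -normrM fE ger0_norm // -natrX.
have f0 : `|f 0| ^+ 2 = 1.
  have := fE 0; rewrite chi0 => /eqP; rewrite -subr_eq0.
  have -> : f 0 * (1 + 1) - 2 = (f 0 - 1) * 2 by ring.
  by rewrite mulf_eq0 pnatr_eq0 orbF subr_eq0 => /eqP->; rewrite normr1 expr1n.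
(* The powers [a ^+ j] with [j < #|gT|] are distinct, so only the diagonal terms of [plancherel]
   survive. *)
have sumf : \sum_i `|f i| ^+ 2 = n * n.
  rewrite /f plancherel //; congr (_ * _).
  transitivity (\sum_(j < #|gT|) (1 : algC)); last by rewrite sumr_const card_ord.
  apply: eq_bigr => j _.
  rewrite (bigD1 j) //= eqxx big1 => [|k nkj].
    by rewrite addr0 mulr1n -normCK normrX normrN1 !expr1n.
  rewrite eq_expg_mod_order oa !modn_small // eq_sym.
  by rewrite (negPf (nkj : (k != j :> nat))).
set B := 4 * _ in boundU.
have : 0 <= \sum_(i | i != 0) `|f i| ^+ 2 * (B - (1 + q * char_sum i [set a; a^-1%g]) ^+ 2).
  apply: sumr_ge0 => i /boundU Bi; rewrite mulr_ge0 ?exprn_ge0 // subr_ge0 //.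
(* The constant term is made opaque so that [big_split] keeps it as a single summand. *)
have [c cE] : {c : algC | c = 8 * q ^+ 2 - 8 * q} by exists (8 * q ^+ 2 - 8 * q).
(* With [w = |f i|^2], the relation [w X = 4 - 2 w] turns the weighted bound into a linear
   expression in [X] and [w], whose sums are both known. *)
have -> : \sum_(i | i != 0) `|f i| ^+ 2 * (B - (1 + q * char_sum i [set a; a^-1%g]) ^+ 2)
  = \sum_(i | i != 0) (c + (- (4 * q ^+ 2)) * char_sum i [set a; a^-1%g]
     + (- (9 + 8 * q)) * `|f i| ^+ 2).
  apply: eq_bigr => i _; have := f2E i; rewrite /B cE; set X := char_sum _ _; 
    set w := `|_| ^+ 2 => fX.
  have wX : w * X = 4 - w * 2 by rewrite -fX; ring.
  by ring: wX.
rewrite sum_nontrivial !big_split /= -!mulr_sumr sumf sum_char_sum //; last first.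
  by rewrite !inE ![1%g == _]eq_sym invg_eq1 (negPf nta).
rewrite sumr_const card_Iirr_ab // f0 char_sum0 cards2 naV -[_ *+ #|gT|]mulr_natr.
(* The cubic terms in [q] cancel exactly; what remains is negative because [q >= 5]. *)
apply: (@int_lt0_contra _ (let q := #|gT|%:Z + 1 in
    - 9 * q ^+ 2 + 34 * q)); last by nia.
rewrite cE /= -(addn1 #|gT|); ring.
Qed.

End EigenvalueBounds.

(** * Classification of the sets whose lifts satisfy the Ramanujan bound *)

Section LiftedEigenvalues.

Variable gT : finGroupType.
Hypothesis abT : abelian [set: gT].
Hypothesis uniq_involution : forall x y : gT, #[x]%g = 2%N -> #[y]%g = 2%N -> x = y.

Local Open Scope ring_scope.

Implicit Types (i : Iirr [set: gT]) (A T U : {set gT}) (K : {group gT}).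

Local Notation chi i := ('chi[[set: gT]]_i).
Local Notation n := (#|gT|%:R : algC).
Local Notation q := (#|gT|.+1%:R : algC).

(* Here gT stands for F_q^*: these are the degree, and the eigenvalue attached to
   the i-th character, of the Cayley graph on pi^-1(T), enlarged by N \ {1} when
   eps is set. *)
Definition lift_degree (eps : bool) T := ((if eps then #|gT| else 0) + #|gT|.+1 * #|T|)%N.

Definition lift_eigenvalue (eps : bool) T i : algC :=
  (if eps then n else 0) + q * char_sum i T.

(** The bound is squared to avoid [sqrtC]. The further eigenvalue [-1] or [0] of the graph is absent
    since it always obeys the bound. *)
Definition lift_ramanujan eps T := forall i,
  let lam := lift_eigenvalue eps T i in let d := (lift_degree eps T)%:R in
  `|lam| != d -> `|lam| ^+ 2 <= 4 * (d - 1).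

Lemma involution_inv_eq (x y : gT) : x != 1%g -> y != 1%g ->
  x = x^-1%g -> y = y^-1%g -> x = y.
Proof.
move=> ntx nty xV yV; apply: uniq_involution; apply/eqP.
  by rewrite order2E ntx -xV eqxx.
by rewrite order2E nty -yV eqxx.
Qed.

Lemma involution_inv_in (A : {set gT}) x y : 1%g \notin A -> x \in A -> y \in A ->
  x = x^-1%g -> y = y^-1%g -> x = y.
Proof.
by move=> A'1 Ax Ay; apply: involution_inv_eq; apply: contraNneq A'1 => <-.
Qed.

(* Otherwise both elements would be involutions. *)
Lemma symmetric_pair U : symmetric_set U -> 1%g \notin U -> #|U| = 2%N ->
  exists2 a, a != a^-1%g & U = [set a; a^-1%g].
Proof.
move=> symU U'1 cU; have /card_gt1P[x [y [Ux Uy nxy]]] : (1 < #|U|)%N by rewrite cU.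
have [xV | nxV] := eqVneq x x^-1%g; last by exists x => //; apply: symmetric_set2.
exists y; last apply: symmetric_set2 => //.
  by apply: contra nxy => /eqP yV; apply/eqP; apply: involution_inv_in Ux Uy xV yV.
by apply: contra nxy => /eqP yV; apply/eqP; apply: involution_inv_in Ux Uy xV yV.
Qed.

(** Inversion has a fixed point on a set of three elements; by uniqueness of the involution the
    other two elements are inverse to each other. *)
Lemma symmetric_triple U : symmetric_set U -> 1%g \notin U -> #|U| = 3%N ->
  exists z a, [/\ (z * z = 1)%g, z != 1%g, a != a^-1%g, (z != a) && (z != a^-1%g)
    & U = [set z; a; a^-1%g]].
Proof.
move=> symU U'1 cU.
have [z Uz zV] : exists2 z, z \in U & z = z^-1%g.
  have /card_gt0P[x Ux] : (0 < #|U|)%N by rewrite cU.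
  have [xV | nxV] := eqVneq x x^-1%g; first by exists x.
  have symD : symmetric_set (U :\: [set x; x^-1%g]).
    move=> y; rewrite !inE => /andP[ny /symU->]; rewrite andbT.
    by rewrite eqg_invLR (inj_eq invg_inj) orbC.
  have cD : #|U :\: [set x; x^-1%g]| = 1%N.
    by rewrite cardsDS ?cU ?cards2 ?nxV // subUset !sub1set Ux symU.
  have [z zV defD] := symmetric_set1 symD cD; exists z => //.
  by have /setP/(_ z) := defD; rewrite !inE eqxx => /andP[].
have [||a naV defa] := symmetric_pair (symmetric_setD1 symU zV).
- by rewrite !inE negb_and U'1 orbT.
- by have := cardsD1 z U; rewrite Uz cU => -[].
have defU : U = [set z; a; a^-1%g] by rewrite -(setD1K Uz) defa setUA.
exists z, a; split=> //; first by apply/eqP; rewrite mulg_eq1 -zV.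
- by apply: contraNneq U'1 => <-.
have /setP/(_ z) := defa; rewrite !inE eqxx /= => /esym/negbT.
by rewrite negb_or.
Qed.

Lemma char_sum_setC1 T i : i != 0 -> 1%g \notin T ->
  char_sum i T = - (1 + char_sum i (~: T :\ 1%g)).
Proof.
move=> nzi T'1; rewrite -[T in LHS]setCK char_sumC //; congr (- _).
by rewrite -(setD1K (_ : 1%g \in ~: T)) ?inE // char_sumD ?char_sum_set1 ?chi1
  ?setD1K ?inE // disjoints1 !inE eqxx.
Qed.

(** The complement [U] of [T], with 1 removed, has at most three elements. Sizes 2 and 3 are
    excluded, and a single element of [U] is an involution. *)
Lemma full_lift_classification T : (1 < #|gT|)%N ->
  symmetric_set T -> 1%g \notin T -> <<T>>%g = [set: gT] ->
  lift_ramanujan true T ->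
  T = [set~ 1%g] \/ (4 <= #|gT|)%N /\ exists2 z : gT, #[z]%g = 2%N & T = ~: [set 1%g; z].
Proof.
move=> n_gt1 symT T'1 genT ramT; set U := ~: T :\ 1%g.
have symU : symmetric_set U.
  by apply: symmetric_setD1; [apply: symmetric_setC | rewrite invg1].
have U'1 : 1%g \notin U by rewrite !inE eqxx.
have CT1 : 1%g \in ~: T by rewrite inE.
have cU : (#|gT| = #|T| + #|U|.+1)%N by rewrite -(cardsC T) (cardsD1 1%g (~: T)) CT1.
have defT : T = ~: (1%g |: U) by rewrite /U setD1K ?setCK.
have T_gt0 : (0 < #|T|)%N.
  rewrite lt0n cards_eq0; apply: contraTneq n_gt1 => T0.
  by rewrite -cardsT -genT T0 gen0 cards1.
(* The bound holds at every nontrivial character: the eigenvalue [d] would contradict generation by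
   [T], and [-d] is out of reach because of the positive summand [n]. *)
have boundU i : i != 0 ->
    (1 + q * char_sum i U) ^+ 2 <= 4 * (q ^+ 2 - q - 2 - q * #|U|%:R).
  move=> nzi; have lamE : lift_eigenvalue true T i = - (1 + q * char_sum i U).
    by rewrite /lift_eigenvalue char_sum_setC1 // -/U; ring.
  have dE : (lift_degree true T)%:R - 1 = q ^+ 2 - q - 2 - q * #|U|%:R.
    by rewrite /lift_degree cU; ring.
  have realX : char_sum i T \is Num.real by apply: char_sum_real.
  have real_lam : lift_eigenvalue true T i \is Num.real.
    by rewrite /lift_eigenvalue rpredD ?rpredM ?rpred_nat.
  rewrite -dE -sqrrN -lamE -real_normK //; apply: ramT.
  have /andP[geT leT] := char_sum_bounds abT i symT.
  have ntT := char_sum_ntriv abT genT nzi.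
  apply/negP; rewrite real_eqr_norml // ler0n andbT => /orP[] /eqP.
    apply/eqP; apply: contraNneq ntT.
    rewrite /lift_eigenvalue /lift_degree natrD natrM => /addrI/mulfI -> //.
    by rewrite pnatr_eq0.
  move=> lamd; suff: lift_eigenvalue true T i > - (lift_degree true T)%:R.
    by rewrite lamd ltxx.
  rewrite /lift_eigenvalue /lift_degree natrD natrM opprD.
  rewrite ltr_leD // ?(ltr_nat _ _ _) //.
    by rewrite (@lt_trans _ _ 0) ?oppr_lt0 ?ltr0n ?(ltn_trans _ n_gt1).
  by rewrite -mulrN ler_wpM2l ?ler0n.
have U_le3 : (#|U| <= 3)%N by apply: full_card_le3 boundU => //; lia.
have [U0 | [U1 | [U2 | U3]]] :
  (#|U| = 0 \/ #|U| = 1 \/ #|U| = 2 \/ #|U| = 3)%N by lia.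
- by left; rewrite defT (cards0_eq U0) setU0.
- right; have [z zV defU] := symmetric_set1 symU U1.
  have oz : #[z]%g = 2%N.
    by apply/eqP; rewrite order2E -zV eqxx andbT; apply: contraNneq U'1 => <-; rewrite defU set11.
  split; last by exists z => //; rewrite defT defU.
  have : (2 %| #|gT|)%N by rewrite -oz -cardsT order_dvdG ?inE.
  move: cU; rewrite U1 => cU /dvdnP[k kE]; lia.
- have [a naV defU] := symmetric_pair symU U'1 U2.
  case: (full_card_ne2 abT naV); first lia.
  move=> i /boundU; rewrite U2 -defU; congr (_ <= _); ring.
have [z [a [zz ntz naV /andP[nza nzV] defU]]] := symmetric_triple symU U'1 U3.
have nta : a != 1%g by apply: contraNneq U'1 => <-; rewrite defU !inE eqxx orbT.
case: (full_card_ne3 abT ntz zz nza nzV nta naV).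
  (* Counting gives at least 5 elements, and the involution [z] makes the number even, hence at
     least 6. *)
  have : (#[z]%g %| #|gT|)%N by rewrite -cardsT order_dvdG ?inE.
  have -> : #[z]%g = 2%N.
    by apply/eqP; rewrite order2E ntz -mulg_eq1 zz eqxx.
  move: cU; rewrite U3 => cU /dvdnP[k kE]; lia.
move=> i /boundU; rewrite U3 -defU; congr (_ <= _); ring.
Qed.

Lemma nil_lift_eigenvalue T i : lift_eigenvalue false T i = q * char_sum i T.
Proof. by rewrite /lift_eigenvalue add0r. Qed.

Lemma nil_lift_bound T i : symmetric_set T -> lift_ramanujan false T ->
    char_sum i T != #|T|%:R -> char_sum i T != - #|T|%:R ->
  q ^+ 2 * char_sum i T ^+ 2 <= 4 * (q * #|T|%:R - 1).
Proof.
move=> symT ramT neT neTN; have realX : char_sum i T \is Num.real by apply: char_sum_real.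
have q_nz : q != 0 by rewrite pnatr_eq0.
rewrite -exprMn -nil_lift_eigenvalue -real_normK ?rpredM ?rpred_nat //; last first.
  by rewrite nil_lift_eigenvalue rpredM ?rpred_nat.
rewrite -natrM; apply: ramT; rewrite nil_lift_eigenvalue natrM.
rewrite normrM ger0_norm ?ler0n // (inj_eq (mulfI q_nz)).
by rewrite real_eqr_norml // negb_and negb_or neT neTN.
Qed.

(** The case of [pi^-1(T)] in which [-d] is no eigenvalue. The second moment leaves at most two
    omitted elements besides 1. One omitted element is refuted by a single character, two by the
    fourth moment. *)
Lemma aperiodic_lift_classification T :
  symmetric_set T -> 1%g \notin T -> <<T>>%g = [set: gT] -> (0 < #|T|)%N ->
  (forall i, i != 0 -> q ^+ 2 * char_sum i T ^+ 2 <= 4 * (q * #|T|%:R - 1)) ->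
  T = [set~ 1%g].
Proof.
move=> symT T'1 genT T_gt0 boundT; set U := ~: T :\ 1%g.
have symU : symmetric_set U.
  by apply: symmetric_setD1; [apply: symmetric_setC | rewrite invg1].
have U'1 : 1%g \notin U by rewrite !inE eqxx.
have CT1 : 1%g \in ~: T by rewrite inE.
have cU : (#|gT| = #|T| + #|U|.+1)%N by rewrite -(cardsC T) (cardsD1 1%g (~: T)) CT1.
have defT : T = ~: (1%g |: U) by rewrite /U setD1K ?setCK.
have U_le2 : (#|U| <= 2)%N.
  rewrite leqNgt; apply/negP => u_gt2.
  have : 0 <= \sum_(i | i != 0) (4 * (q * #|T|%:R - 1) + 0 * char_sum i T
     + (- q ^+ 2) * char_sum i T ^+ 2 + 0 * char_sum i T ^+ 3
     + 0 * char_sum i T ^+ 4).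
    apply: sumr_ge0 => i /boundT; rewrite -subr_ge0; congr (0 <= _); ring.
  rewrite sum_poly4 // parseval // char_sum0 cU; move: #|T| #|U| T_gt0 u_gt2 => t u t0 u2.
  apply: (@int_lt0_contra _ (let u := u%:Z in let t := t%:Z in let q := u + t + 2 in
    (4 * (q * t - 1)) * (q - 2) - q ^+ 2 * (t * (u + 1)))); first by rewrite /=; ring.
  nia.
have [U0 | [U1 | U2]] : (#|U| = 0 \/ #|U| = 1 \/ #|U| = 2)%N by lia.
- by rewrite defT (cards0_eq U0) setU0.
- have [z zV defU] := symmetric_set1 symU U1.
  have ntz : z != 1%g by apply: contraNneq U'1 => <-; rewrite defU set11.
  have oz : #[z]%g = 2%N by apply/eqP; rewrite order2E -zV eqxx andbT.
  (* A nontrivial character with [chi i z = 1] takes the value -2 on [T], which is too large in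
     modulus. *)
  have : <[z]>%g != [set: gT].
    apply/eqP=> genz; have : #|gT| = 2%N by rewrite -cardsT -genz -orderE.
    move=> n2; have T1 : #|T| = 0%N by move: cU; rewrite n2 U1; lia.
    by rewrite T1 in T_gt0.
  case/exists_chi_ker=> // i nzi /(_ z (cycle_id z)) chiz.
  exfalso; have := boundT i nzi; rewrite char_sum_setC1 // -/U defU char_sum_set1 chiz -subr_ge0.
  have -> : #|gT| = (#|T| + 2)%N by rewrite cU U1.
  move: #|T| => t.
  apply: (@int_lt0_contra _ (let t := t%:Z in let q := t + 3 in
    4 * (q * t - 1) - q ^+ 2 * 4)); first by rewrite /=; ring.
  nia.
exfalso; have [a naV defU] := symmetric_pair symU U'1 U2.
have nta : a != 1%g by apply: contraNneq U'1 => <-; rewrite defU !inE eqxx.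
(* For [#|T| = 1] the moment inequality below yields no contradiction; a one-element symmetric
   generating set forces a group of order 2, while the group has order [#|T| + 3]. *)
have T_gt1 : (1 < #|T|)%N.
  rewrite ltn_neqAle T_gt0 andbT eq_sym; apply/eqP => T1.
  have [z zV defTz] := symmetric_set1 symT T1.
  have ntz : z != 1%g by apply: contraNneq T'1 => <-; rewrite defTz set11.
  have oz : #[z]%g = 2%N by apply/eqP; rewrite order2E -zV eqxx andbT.
  have : #|gT| = 2%N by rewrite -cardsT -genT defTz -orderE.
  by rewrite cU U2; lia.
have n1a : (1%g : gT) != a by rewrite eq_sym.
have n1aV : (1%g : gT) != a^-1%g by rewrite eq_sym invg_eq1.
(* The moments are taken with [e = 1]: the triple is the whole complement of [T], so the sums over
   it and over [T] are opposite at nontrivial characters. *)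
have [M2 _ M4] := moments_triple abT (mulg1 1%g) n1a n1aV naV.
set X := (fun i => char_sum i [set 1%g; a; a^-1%g]) in M2 M4.
have defC : ~: T = [set 1%g; a; a^-1%g] by rewrite -setUA -defU /U setD1K.
have X0 : X 0 = 3.
  by rewrite /X char_sum0 -defC -(setD1K CT1) cardsU1 -/U U2 U'1.
have : 0 <= \sum_(i | i != 0) (0 + 0 * X i + (4 * (q * #|T|%:R - 1)) * X i ^+ 2
     + 0 * X i ^+ 3 + (- q ^+ 2) * X i ^+ 4).
  apply: sumr_ge0 => i nzi; have := boundT i nzi; rewrite -subr_ge0 => Bi.
  set B := 4 * _ in Bi *.
  have -> : 0 + 0 * X i + B * X i ^+ 2 + 0 * X i ^+ 3 + - q ^+ 2 * X i ^+ 4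
     = X i ^+ 2 * (B - q ^+ 2 * X i ^+ 2) by ring.
  rewrite mulr_ge0 //; last by rewrite /X -defC char_sumC // sqrrN.
  rewrite real_exprn_even_ge0 // char_sum_real // -defC; exact: symmetric_setC.
rewrite sum_poly4 // M2 X0 => ge0.
have {ge0 M2 M4} : 0 <= (4 * (q * #|T|%:R - 1)) * (n * 3 - 9) - q ^+ 2 * (19 * n - 81).
  apply: le_trans ge0 _; rewrite -subr_ge0; set m4 := \sum_i _ ^+ 4 in M4 *.
  set D := _ - _; have -> : D = q ^+ 2 * (m4 - n * 19) by rewrite /D; ring.
  by rewrite mulr_ge0 ?exprn_ge0 ?subr_ge0.
rewrite cU U2; move: #|T| T_gt1 => t t_gt1.
apply: (@int_lt0_contra _ (let t := t%:Z in let q := t + 4 in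
    (4 * (q * t - 1)) * (t * 3) - q ^+ 2 * (19 * t - 24))); first by rewrite /=; ring.
nia.
Qed.

Lemma char_sum_min_neq0 T i : (0 < #|T|)%N -> char_sum i T = - #|T|%:R -> i != 0.
Proof.
move=> T_gt0 sumT; apply: contraTneq T_gt0 => i0.
move: sumT; rewrite i0 char_sum0 => /eqP.
by rewrite -addr_eq0 -natrD pnatr_eq0 addn_eq0 andbb => /eqP->.
Qed.

(** The character equals -1 on the generating set [T], so its values are signs and its kernel [K]
    has index two. *)
Lemma sign_char_kernel T i0 : <<T>>%g = [set: gT] -> (0 < #|T|)%N ->
  char_sum i0 T = - #|T|%:R ->
  exists2 K : {group gT}, (#|gT| = 2 * #|K|)%N & T \subset ~: K.
Proof.
move=> genT T_gt0 sumT; have chiT := char_sum_min abT sumT.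
have gK : group_set [set x | chi i0 x == 1].
  apply/group_setP; split=> [|x y]; rewrite !inE ?chi1 //.
  by rewrite !chiM // => /eqP-> /eqP->; rewrite mulr1.
have gE : group_set [set x | chi i0 x ^+ 2 == 1].
  apply/group_setP; split=> [|x y]; rewrite !inE ?chi1 ?expr1n //.
  by rewrite !chiM // exprMn => /eqP-> /eqP->; rewrite mulr1.
have nz_i0 := char_sum_min_neq0 T_gt0 sumT.
pose K := Group gK; exists K; last first.
  by apply/subsetP=> x Tx; rewrite !inE chiT // eqNr oner_eq0.
have chi_sgn x : x \notin K -> chi i0 x = -1.
  have : <<T>>%g \subset Group gE.
    by rewrite gen_subG; apply/subsetP=> y Ty; rewrite inE chiT // sqrrN expr1n.
  rewrite genT => /subsetP/(_ x (in_setT x)); rewrite !inE sqrf_eq1.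
  by case/orP=> /eqP -> //; rewrite eqxx.
(* The sum over the whole group vanishes, so the values 1 and -1 occur equally often. *)
have : char_sum i0 (~: K) = - char_sum i0 K by rewrite char_sumC.
rewrite /char_sum (eq_bigr (fun=> -1)); last by move=> x; rewrite inE => /chi_sgn.
rewrite [in RHS](eq_bigr (fun=> 1)); last by move=> x; rewrite inE => /eqP.
rewrite !sumr_const mulNrn => /oppr_inj/eqP; rewrite eqr_nat => /eqP cKC.
by rewrite -(cardsC K) cKC mul2n addnn.
Qed.

(** Here [-d] is an eigenvalue. The second moment over the characters other than [0] and [i0] shows
    that [T] misses at most one element of the coset [~: K]. *)
Lemma bipartite_lift_classification T i0 :
  symmetric_set T -> <<T>>%g = [set: gT] -> (0 < #|T|)%N -> lift_ramanujan false T ->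
  char_sum i0 T = - #|T|%:R ->
  exists2 K : {group gT}, (#|gT| = 2 * #|K|)%N &
    T = ~: K \/ (6 <= #|gT|)%N /\
      exists z : gT, [/\ z \notin K, #[z]%g = 2%N & T = ~: K :\ z].
Proof.
move=> symT genT T_gt0 ramT sumT; have chiT := char_sum_min abT sumT.
have nz_i0 := char_sum_min_neq0 T_gt0 sumT.
have [K cK sTK] := sign_char_kernel genT T_gt0 sumT.
have sW : symmetric_set (~: K :\: T).
  move=> x; rewrite !inE => /andP[nTx nKx]; rewrite groupV nKx andbT.
  by apply: contra nTx => /symT; rewrite invgK.
have cKC : #|~: K| = #|K| by have := cardsC K; rewrite cK; lia.
have cW : (#|K| = #|T| + #|~: K :\: T|)%N.
  by rewrite -cKC -(cardsID T (~: K)) (setIidPr sTK).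
have W_le1 : (#|~: K :\: T| <= 1)%N.
  rewrite leqNgt; apply/negP=> w_gt1.
  pose f i := 4 * (q * #|T|%:R - 1) + 0 * char_sum i T
     + (- q ^+ 2) * char_sum i T ^+ 2 + 0 * char_sum i T ^+ 3
     + 0 * char_sum i T ^+ 4.
  (* Since [T] generates, [i0] is the only character with value -1 on [T]; every other nontrivial
     one obeys the bound. *)
  have : 0 <= \sum_(i | i != 0) f i - f i0.
    rewrite (bigD1 i0) //= addrAC subrr add0r; apply: sumr_ge0 => i /andP[nzi ni0].
    have : q ^+ 2 * char_sum i T ^+ 2 <= 4 * (q * #|T|%:R - 1).
      apply: nil_lift_bound => //; first exact: char_sum_ntriv.
      apply: contraNneq ni0 => /(char_sum_min abT) chiTi; apply/eqP.
      by apply: (chi_eq_gen abT genT) => x Tx; rewrite chiT ?chiTi.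
    by rewrite -subr_ge0 /f; congr (0 <= _); ring.
  rewrite /f sum_poly4 // parseval // char_sum0 sumT cK cW.
  move: #|T| #|~: K :\: T| T_gt0 w_gt1 => t w t0 w1.
  apply: (@int_lt0_contra _ (let w := w%:Z in let t := t%:Z in let q := 2 * (t + w) + 1 in
    (4 * (q * t - 1)) * (q - 3) - q ^+ 2 * (2 * t * w))); first by rewrite /=; ring.
  nia.
exists K => //; have [W0 | W1] : (#|~: K :\: T| = 0 \/ #|~: K :\: T| = 1)%N by lia.
  left; apply/eqP; rewrite eqEsubset sTK -setD_eq0.
  by rewrite (cards0_eq W0) eqxx.
have [z zV defW] := symmetric_set1 sW W1.
have [nTz nKz] : z \notin T /\ z \notin K.
  by have /setP/(_ z) := defW; rewrite !inE eqxx => /andP[].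
have ntz : z != 1%g by apply: contraNneq nKz => ->.
have defT : T = ~: K :\ z by rewrite -defW setDDr setDv set0U (setIidPr sTK).
right; split; last first.
  by exists z; split=> //; apply/eqP; rewrite order2E ntz -zV eqxx.
(* If [T] were a singleton, its element would be an involution and hence equal to the omitted
   [z]. *)
have T_gt1 : (1 < #|T|)%N.
  rewrite ltn_neqAle T_gt0 andbT eq_sym; apply/eqP => T1.
  have [x xV defTx] := symmetric_set1 symT T1.
  have Tx : x \in T by rewrite defTx set11.
  have ntx : x != 1%g.
    by apply: contraTneq (subsetP sTK x Tx) => ->; rewrite !inE group1.
  by rewrite -(involution_inv_eq ntx ntz xV zV) Tx in nTz.
by rewrite cK cW W1; lia.
Qed.

End LiftedEigenvalues.

Lemma int_ge0_ler (x y : algC) (z : int) :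
  (y - x = z%:~R -> 0 <= z -> x <= y)%R.
Proof. by move=> yx z_ge0; rewrite -subr_ge0 yx ler0z. Qed.

(** * The case without translations concluded, and the sets that satisfy the bound *)

Section LiftedExamples.

Variable gT : finGroupType.
Hypothesis abT : abelian [set: gT].

Local Open Scope ring_scope.

Implicit Types (i : Iirr [set: gT]) (A T U : {set gT}) (K : {group gT}).

Local Notation chi i := ('chi[[set: gT]]_i).
Local Notation n := (#|gT|%:R : algC).
Local Notation q := (#|gT|.+1%:R : algC).

Lemma nil_lift_classification T :
  (forall x y : gT, #[x]%g = 2%N -> #[y]%g = 2%N -> x = y) ->
  symmetric_set T -> 1%g \notin T -> <<T>>%g = [set: gT] -> (0 < #|T|)%N ->
  lift_ramanujan false T ->
  T = [set~ 1%g] \/ exists2 K : {group gT}, (#|gT| = 2 * #|K|)%N &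
    T = ~: K \/ (6 <= #|gT|)%N /\
      exists z : gT, [/\ z \notin K, #[z]%g = 2%N & T = ~: K :\ z].
Proof.
move=> uniq symT T'1 genT T_gt0 ramT.
have [i0 /eqP sumT | no_min] := pickP (fun i => char_sum i T == - #|T|%:R).
  by right; apply: (bipartite_lift_classification abT uniq symT genT T_gt0 ramT sumT).
left; apply: aperiodic_lift_classification => // i nzi.
by apply: nil_lift_bound; rewrite ?no_min ?char_sum_ntriv.
Qed.

Lemma lift_ramanujanI eps T :
  (forall i, i != 0 -> let lam := lift_eigenvalue eps T i in
     let d := (lift_degree eps T)%:R in `|lam| = d \/ `|lam| ^+ 2 <= 4 * (d - 1)) ->
  lift_ramanujan eps T.
Proof.
move=> ramT i lam d; have [i0 | nzi] := eqVneq i 0; last first.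
  by have [|//] := ramT i nzi; rewrite -/lam -/d => ->; rewrite eqxx.
case/eqP; rewrite /lam /d /lift_eigenvalue /lift_degree i0 char_sum0 natrD natrM.
by case: eps {lam d ramT}; rewrite ger0_norm ?addr_ge0 ?mulr_ge0 ?ler0n.
Qed.

Lemma char_sum_group i K : char_sum i K = #|K|%:R \/ char_sum i K = 0.
Proof.
have [x /andP[Kx ntx] | chiK] := pickP [pred x in K | chi i x != 1]; last first.
  left; rewrite /char_sum (eq_bigr (fun=> 1)) ?sumr_const // => x Kx.
  by apply/eqP; have /negbT := chiK x; rewrite /= Kx negbK.
right; apply/eqP; have /eqP: chi i x * char_sum i K = char_sum i K.
  rewrite /char_sum mulr_sumr [RHS](reindex_inj (mulgI x)) /=.
  by apply: eq_big => [y|y _]; rewrite ?groupMl ?chiM.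
by rewrite -subr_eq0 -{2}[char_sum _ _]mul1r -mulrBl mulf_eq0 subr_eq0 (negPf ntx).
Qed.

Section AllNontrivial.

Hypothesis n_gt1 : (1 < #|gT|)%N.

Let char_sumC1 i : i != 0 -> char_sum i [set~ 1%g] = -1.
Proof. by move=> nzi; rewrite char_sumC // char_sum_set1 chi1. Qed.

Let cardC1' : #|[set~ (1%g : gT)]| = #|gT|.-1.
Proof. by rewrite cardsC1. Qed.

Lemma setC1_gen : <<[set~ (1%g : gT)]>>%g = [set: gT].
Proof.
apply: gen_char_sum => // i nzi; rewrite char_sumC1 // lt_eqF //.
by rewrite (lt_le_trans (ltrN10 _)) ?ler0n.
Qed.

Lemma setC1_full_ramanujan : lift_ramanujan true [set~ (1%g : gT)].
Proof.
apply: lift_ramanujanI => i nzi /=; right.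
rewrite /lift_eigenvalue /lift_degree char_sumC1 // cardC1'.
have -> : n + q * -1 = -1 by ring.
rewrite normrN1 expr1n; move: #|gT| n_gt1 => [|[|m]] // _ /=.
apply: (@int_ge0_ler _ _ (let m := m%:Z in 4 * (m + 1 + (m + 3) * (m + 1)) - 1)).
  by rewrite /=; ring.
nia.
Qed.

Lemma setC1_nil_ramanujan : lift_ramanujan false [set~ (1%g : gT)].
Proof.
apply: lift_ramanujanI => i nzi /=.
rewrite nil_lift_eigenvalue /lift_degree char_sumC1 // cardC1' mulrN1 normrN ger0_norm ?ler0n //.
(* For a group of order 2 the eigenvalue [-q] is minus the degree (bipartite case); otherwise the
   bound itself holds. *)
move: #|gT| n_gt1 => [|[|[|m]]] // _; [by left | right].
apply: (@int_ge0_ler _ _ (let m := m%:Z in 4 * ((m + 4) * (m + 2) - 1) - (m + 4) ^+ 2)).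
  by rewrite /=; ring.
nia.
Qed.

End AllNontrivial.

Section OmitInvolution.

Variable z : gT.
Hypotheses (oz : #[z]%g = 2%N) (n_gt3 : (3 < #|gT|)%N).

Let card_omit : #|~: [set 1%g; z]| = (#|gT| - 2)%N.
Proof.
by rewrite cardsCs setCK cards2 eq_sym -order_gt1 oz.
Qed.

Let char_sum_omit i : i != 0 -> char_sum i (~: [set 1%g; z]) = - (1 + chi i z).
Proof.
move=> nzi; rewrite char_sumC // char_sumD ?char_sum_set1 ?chi1 //.
by rewrite disjoints1 inE eq_sym -order_eq1 oz.
Qed.

Let chi_z i : chi i z = 1 \/ chi i z = -1.
Proof.
have /eqP: chi i z ^+ 2 = 1 by rewrite -chiX // -oz expg_order chi1.
by rewrite sqrf_eq1 => /orP[] /eqP ->; [left | right].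
Qed.

Lemma omit_gen : <<~: [set 1%g; z]>>%g = [set: gT].
Proof.
apply: gen_char_sum => // i nzi; rewrite char_sum_omit // card_omit lt_eqF //.
apply: le_lt_trans (_ : 0 < _); last by rewrite ltr0n subn_gt0 ltnW.
by rewrite oppr_le0; case: (chi_z i) => ->; rewrite ?subrr ?addr_ge0.
Qed.

Lemma omit_full_ramanujan : lift_ramanujan true (~: [set 1%g; z]).
Proof.
apply: lift_ramanujanI => i nzi /=; right.
rewrite /lift_eigenvalue /lift_degree char_sum_omit // card_omit.
rewrite real_normK; last first.
  have chiR : chi i z \is Num.real by case: (chi_z i) => ->; rewrite ?rpredN ?rpred1.
  by rewrite rpredD ?rpred_nat // rpredM ?rpred_nat // rpredN rpredD ?rpred1.
have -> : #|gT| = (#|gT| - 4 + 4)%N by rewrite subnK.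
move: (#|gT| - 4)%N => m; rewrite -addnBA // (_ : 4 - 2 = 2)%N //.
case: (chi_z i) => ->.
  apply: (@int_ge0_ler _ _ (let m := m%:Z in
     4 * (m + 3 + (m + 5) * (m + 2)) - (m + 6) ^+ 2)); first by rewrite /=; ring.
  nia.
apply: (@int_ge0_ler _ _ (let m := m%:Z in
   4 * (m + 3 + (m + 5) * (m + 2)) - (m + 4) ^+ 2)); first by rewrite /=; ring.
nia.
Qed.

End OmitInvolution.

Section IndexTwo.

Variable K : {group gT}.
Hypothesis cK : (#|gT| = 2 * #|K|)%N.

Lemma card_index2C : #|~: K| = #|K|.
Proof. by have := cardsC K; rewrite cK mul2n -addnn => /addnI. Qed.

Lemma index2_gen : <<~: K>>%g = [set: gT].
Proof.
apply: gen_char_sum => // i nzi; rewrite char_sumC // card_index2C lt_eqF //.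
apply: le_lt_trans (_ : 0 < _); last by rewrite ltr0n cardG_gt0.
by rewrite oppr_le0; case: (char_sum_group i K) => ->; rewrite ?ler0n.
Qed.

(** A character sums to [#|K|] or 0 on [K], so the only values are [d], [-d] and 0, as in a complete
    bipartite graph. *)
Lemma index2_nil_ramanujan : lift_ramanujan false (~: K).
Proof.
apply: lift_ramanujanI => i nzi /=.
rewrite nil_lift_eigenvalue /lift_degree char_sumC // card_index2C.
case: (char_sum_group i K) => ->.
  by left; rewrite mulrN normrN -natrM ger0_norm ?ler0n.
right; rewrite oppr0 mulr0 normr0 expr0n /= mulr_ge0 // subr_ge0 add0n.
by rewrite (ler_nat _ 1) muln_gt0 cardG_gt0.
Qed.

Section OmitInvolution.

Variable z : gT.
Hypotheses (K'z : z \notin K) (K_gt2 : (2 < #|K|)%N).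

Let card_omit : #|~: K :\ z| = #|K|.-1.
Proof. by have := cardsD1 z (~: K); rewrite inE K'z card_index2C => ->. Qed.

Let char_sum_omit i : i != 0 ->
  char_sum i (~: K :\ z) = - (#|K|.-1)%:R \/ char_sum i (~: K :\ z) = - chi i z.
Proof.
move=> nzi; have : char_sum i (~: K) = chi i z + char_sum i (~: K :\ z).
  rewrite -{1}(setD1K (_ : z \in ~: K)) ?inE // char_sumD ?char_sum_set1 //.
  by rewrite disjoints1 !inE eqxx.
rewrite char_sumC //; case: (char_sum_group i K) => -> => [sumK|]; last first.
  by move/eqP; rewrite oppr0 eq_sym addrC addr_eq0 => /eqP; right.
(* A nontrivial character that is trivial on [K] attains the minimum on the coset, hence is -1
   there. *)
left; have chiz : chi i z = -1.
  have sumKC : char_sum i (~: K) = - #|~: K|%:R.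
    by rewrite card_index2C sumK -{1}(setD1K (_ : z \in ~: K)) ?inE // char_sumD ?char_sum_set1 //
       disjoints1 !inE eqxx.
  by apply: (char_sum_min abT sumKC); rewrite inE.
move: sumK; rewrite chiz -(ltn_predK K_gt2) /= => /eqP.
rewrite -subr_eq0 => /eqP E; apply/eqP; rewrite -subr_eq0; apply/eqP.
by rewrite -[RHS]oppr0 -E; ring.
Qed.

Lemma index2_omit_gen : <<~: K :\ z>>%g = [set: gT].
Proof.
apply: gen_char_sum => // i nzi; rewrite card_omit.
have K1_gt1 : (1 < #|K|.-1)%N by rewrite -ltnS (ltn_predK K_gt2).
case: (char_sum_omit nzi) => -> {nzi}.
  rewrite lt_eqF // (lt_trans (_ : _ < 0)) ?oppr_lt0 ?ltr0n //; exact: ltnW.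
apply/eqP => /(congr1 Num.norm); rewrite normrN norm_chi // normr_nat => /eqP.
by rewrite eq_sym (eqr_nat _ _ 1) gtn_eqF.
Qed.

Lemma index2_omit_nil_ramanujan : lift_ramanujan false (~: K :\ z).
Proof.
apply: lift_ramanujanI => i nzi /=.
rewrite nil_lift_eigenvalue /lift_degree card_omit.
case: (char_sum_omit nzi) => ->.
  by left; rewrite mulrN normrN -natrM ger0_norm ?ler0n.
right; rewrite normrM normrN norm_chi // mulr1 normr_nat cK.
move: #|K| K_gt2 => [|[|[|k]]] // _.
(* Here [k = #|K| - 3]. At [k = 0] the inequality reads [49 <= 52]; for [#|K| = 2] it would fail. *)
apply: (@int_ge0_ler _ _ (let k := k%:Z in
   4 * ((2 * k + 7) * (k + 2) - 1) - (2 * k + 7) ^+ 2)); first by rewrite /=; ring.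
nia.
Qed.

End OmitInvolution.

End IndexTwo.

End LiftedExamples.

(** * The affine group *)

Section Units.

Variable F : finFieldType.

Lemma unitsT_abelian : abelian [set: {unit F}].
Proof. exact: cyclic_abelian (field_unit_group_cyclic _). Qed.

Lemma card_units : #|F| = #|{: {unit F}}|.+1.
Proof.
have := card_finField_unit F; rewrite cardsT => ->.
by rewrite prednK // (ltn_trans _ (finNzRing_gt1 F)).
Qed.

(** In a field the only square root of 1 other than 1 is -1. *)
Lemma unit_involution (x y : {unit F}) : #[x]%g = 2 -> #[y]%g = 2 -> x = y.
Proof.
suff invN (z : {unit F}) : #[z]%g = 2 -> val z = (-1)%R.
  by move=> /invN xN /invN yN; apply: val_inj; rewrite /= xN yN.
move=> oz; have /(congr1 val) /= : (z ^+ 2)%g = 1%g by rewrite -oz expg_order.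
rewrite FinRing.val_unitX => /eqP; rewrite sqrf_eq1 => /orP[] /eqP // z1.
suff z1' : z = 1%g by rewrite z1' order1 in oz.
exact: val_inj.
Qed.

End Units.

Section AffineGroup.

Variable F : finFieldType.
Local Notation G := (AGL1 F).
Local Notation lin := (@linear_part F).

Fact affine_proof (hv : {unit F} * F) : hv \in setX [set: {unit F}] [set: F].
Proof. by rewrite !inE. Qed.

Definition affine (h : {unit F}) (v : F) : G :=
  @SdPair _ _ _ _ (FinRing.unit_groupAction F) (h, v) (affine_proof (h, v)).

Definition shift (x : G) : F :=
  (pair_of_sd (x : sdprod_by (FinRing.unit_groupAction F))).2.

Lemma lin_affine h v : lin (affine h v) = h. Proof. by []. Qed.
Lemma shift_affine h v : shift (affine h v) = v. Proof. by []. Qed.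

Lemma affine_inj (x y : G) : lin x = lin y -> shift x = shift y -> x = y.
Proof.
move=> eq1 eq2; apply: val_inj; rewrite /= [LHS]surjective_pairing.
by rewrite [RHS]surjective_pairing; congr (_, _).
Qed.

Lemma affine_eta (x : G) : x = affine (lin x) (shift x).
Proof. exact: affine_inj. Qed.

Lemma linM (x y : G) : lin (x * y)%g = (lin x * lin y)%g. Proof. by []. Qed.
Lemma lin1 : lin 1%g = 1%g. Proof. by []. Qed.
Lemma linV (x : G) : lin x^-1%g = (lin x)^-1%g. Proof. by []. Qed.

Lemma shiftM (x y : G) : shift (x * y)%g = (shift x * FinRing.uval (lin y) + shift y)%R.
Proof. by []. Qed.

Lemma shiftV (x : G) : shift x^-1%g = (- shift x * (FinRing.uval (lin x))^-1)%R.
Proof. by []. Qed.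

Lemma mem_translations (x : G) : (x \in translations F) = (lin x == 1%g).
Proof.
apply/morphimP/eqP => [[v _ _ ->]|x1]; first by rewrite /linear_part val_insubd !inE.
exists (shift x); rewrite ?inE //; apply: affine_inj.
  by rewrite /linear_part val_insubd !inE.
by rewrite /shift val_insubd !inE.
Qed.

Lemma card_lin_fiber h : #|[set x : G | lin x == h]| = #|F|.
Proof.
rewrite -(card_imset predT (can_inj (shift_affine h))); apply: eq_card => x.
rewrite inE; apply/eqP/imsetP => [<-|[v _ ->//]].
by exists (shift x) => //; apply: affine_eta.
Qed.

(** Conjugation by the translation by [m] adds [m (1 - lin x)] to the shift, and [1 - lin x] is
    invertible; so every fibre other than [N] is one class. *)
Lemma conj_lin_neq1 (x y : G) : lin x != 1%g -> lin x = lin y ->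
  y \in (x ^: [set: G])%g.
Proof.
move=> ntx eq_xy; pose m := ((shift y - shift x) / (1 - FinRing.uval (lin x)))%R.
have nz : (1 - FinRing.uval (lin x))%R != 0%R.
  by rewrite subr_eq0 eq_sym; apply: contra ntx => /eqP x1; apply/eqP/val_inj.
apply/imsetP; exists (affine 1%g m); rewrite ?inE // /conjg; apply: affine_inj.
  by rewrite !linM linV lin_affine invg1 mul1g mulg1.
rewrite !shiftM shiftV !shift_affine !linM !lin_affine mulg1 /= /m.
move: nz; set a := FinRing.uval (lin x); set b := shift x; set c := shift y => nz.
by field; rewrite nz oner_eq0.
Qed.

(** Conjugation by a dilation rescales the shift, so [N] without 1 is a single class. *)
Lemma conj_translations (x y : G) : lin x = 1%g -> lin y = 1%g ->
  x != 1%g -> y != 1%g -> y \in (x ^: [set: G])%g.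
Proof.
move=> x1 y1 ntx nty.
have nz (z : G) : lin z = 1%g -> z != 1%g -> shift z != 0%R.
  by move=> z1; apply: contra => /eqP z0; apply/eqP/affine_inj.
have u : (shift y / shift x)%R \is a GRing.unit.
  by rewrite unitfE mulf_neq0 ?invr_eq0 ?nz.
apply/imsetP; exists (affine (FinRing.unit F u) 0%R); rewrite ?inE // /conjg.
apply: affine_inj; rewrite ?linM ?x1 ?y1 ?linV ?mul1g ?mulVg //.
rewrite !shiftM shiftV !shift_affine !linM !lin_affine x1 mul1g /=.
rewrite oppr0 !mul0r add0r addr0.
by rewrite mulrC divfK ?nz.
Qed.

End AffineGroup.

(** * Cayley graphs on lifted sets *)

Section CayleyGraphs.

Variable gT : finGroupType.
Implicit Type S : {set gT}.

(** Left translations preserve adjacency, so the elements reachable from 1 form a subgroup; it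
    contains [S]. *)
Lemma connected_cayley S : <<S>>%g = [set: gT] -> connected_graph (cayley S).
Proof.
move=> genS.
have trans x y z : connect (cayley S) x y -> connect (cayley S) (z * x)%g (z * y)%g.
  case/connectP=> p; elim: p x => [|u p IHp] x /=; first by move=> _ ->; rewrite connect0.
  case/andP=> Sxu path_p def_y; apply: connect_trans (IHp u path_p def_y).
  by apply: connect1; rewrite /cayley invMg mulgA mulgKV.
have gC : group_set [set y | connect (cayley S) 1%g y].
  apply/group_setP; split=> [|x y]; rewrite !inE ?connect0 // => c1x c1y.
  by apply: connect_trans c1x _; have := trans _ _ x c1y; rewrite mulg1.
move=> x y; have : <<S>>%g \subset Group gC.
  rewrite gen_subG; apply/subsetP=> z Sz; rewrite inE; apply: connect1.
  by rewrite /cayley invg1 mul1g.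
rewrite genS => /subsetP/(_ (x^-1 * y)%g (in_setT _)); rewrite inE => /(trans _ _ x).
by rewrite mulg1 mulKVg.
Qed.

Lemma regular_cayley S : regular_graph (cayley S) #|S|.
Proof.
move=> x; rewrite -(card_lcoset S x); apply: eq_card => y.
by rewrite !inE mem_lcoset.
Qed.

Lemma normal_connection_setP S :
  normal_connection_set S <->
  [/\ 1%g \notin S, symmetric_set S, <<S>>%g = [set: gT]
    & forall x y, x \in S -> y \in (x ^: [set: gT])%g -> y \in S].
Proof.
split=> [[sS1 symS genS [P sPcl defS]] | [S'1 symS genS clS]].
  split=> //; first by have := subsetP sS1 1%g; rewrite !inE eqxx => S1; apply/negP=> /S1.
  move=> x y; rewrite defS => /bigcupP[A PA Ax] xy; apply/bigcupP; exists A => //.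
  have /imsetP[z _ defA] := subsetP sPcl A PA.
  by rewrite defA -(class_eqP (_ : x \in (z ^: _)%g)) // -defA.
split=> //; first by rewrite subsetD1 subsetT.
exists [set (x ^: [set: gT])%g | x in S].
  by apply/subsetP=> A /imsetP[x _ ->]; apply: imset_f.
apply/setP=> x; apply/idP/bigcupP => [Sx | [A /imsetP[y Sy ->]]].
  by exists (x ^: [set: gT])%g; [apply: imset_f | apply: class_refl].
exact: clS Sy.
Qed.

End CayleyGraphs.

(** Replaces row vectors indexed by an enumeration with functions on the vertices. *)
Lemma eigenvalue_adjacency (T : finType) (e : rel T) (lam : algC) :
  eigenvalue (adjacency_mx e) lam <->
  exists2 f : T -> algC, exists x, (f x != 0)%R &
    forall y, (\sum_x f x * (e x y)%:R = lam * f y)%R.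
Proof.
have sumE (v : 'rV[algC]_#|T|) j : ((v *m adjacency_mx e) 0 j
    = \sum_x v 0 (enum_rank x) * (e x (enum_val j))%:R)%R.
  rewrite mxE (reindex (@enum_rank T)) /=; last exact: onW_bij (enum_rank_bij T).
  by apply: eq_bigr => x _; rewrite mxE enum_rankK.
split=> [/eigenvalueP[v vA nz_v] | [f [x nz_fx] fA]].
  have [j nz_vj] : exists j, (v 0 j != 0)%R.
    apply/existsP; apply: contraNT nz_v; rewrite negb_exists => /forallP v0.
    by apply/eqP/rowP=> j; rewrite mxE; apply/eqP; move: (v0 j); rewrite negbK.
  exists (fun x => v 0 (enum_rank x))%R; first by exists (enum_val j); rewrite enum_valK.
  by move=> y; rewrite -{1}[y]enum_rankK -sumE vA mxE.
apply/eigenvalueP; exists (\row_j f (enum_val j))%R.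
  apply/rowP=> j; rewrite sumE !mxE -fA.
  by apply: eq_bigr => y _; rewrite mxE enum_rankK.
apply: contraNneq nz_fx => /rowP/(_ (enum_rank x)).
by rewrite !mxE enum_rankK => ->.
Qed.

(** * Normal connection sets as lifts of subsets of the unit group *)

Section LiftedSets.

Variable F : finFieldType.
Local Notation G := (AGL1 F).
Local Notation lin := (@linear_part F).
Local Notation gU := [set: {unit F}].
Implicit Type T : {set {unit F}}.

Definition lift_set (eps : bool) T : {set G} :=
  (if eps then translations F :\ 1%g else set0) :|: lin @^-1: T.

Lemma mem_lift_set eps T x :
  (x \in lift_set eps T) = [&& eps, lin x == 1%g & x != 1%g] || (lin x \in T).
Proof.
rewrite /lift_set; case: eps; last by rewrite !inE.
by rewrite !inE mem_translations [(x != _) && _]andbC.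
Qed.

Lemma card_lin_preim T : #|lin @^-1: T| = (#|F| * #|T|)%N.
Proof.
rewrite -sum1_card (partition_big lin (mem T)) /=; last by move=> x; rewrite inE.
rewrite mulnC -sum_nat_const; apply: eq_bigr => h Th.
rewrite sum1_card -(card_lin_fiber h); apply: eq_card => x.
by rewrite unfold_in /= !inE; case: eqP => [->|]; rewrite ?andbT ?andbF.
Qed.

Lemma card_lift_set eps T : 1%g \notin T -> #|lift_set eps T| = lift_degree eps T.
Proof.
move=> T'1; rewrite /lift_degree -card_units -card_lin_preim /lift_set.
rewrite cardsU; case: eps; last by rewrite set0I cards0 subn0.
have -> : (translations F :\ 1%g) :&: lin @^-1: T = set0.
  apply/setP=> x; rewrite !inE mem_translations; apply/negP=> /andP[/andP[_ /eqP->]].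
  exact/negP.
rewrite cards0 subn0; congr (_ + _)%N; apply: succn_inj; rewrite -card_units.
rewrite -(card_lin_fiber 1%g) [in RHS](cardsD1 1%g) inE lin1 eqxx.
by congr _.+1; apply: eq_card => x; rewrite !inE mem_translations.
Qed.

Lemma normal_lift_set eps T : T != set0 -> 1%g \notin T -> symmetric_set T ->
  <<T>>%g = gU -> normal_connection_set (lift_set eps T).
Proof.
move=> nzT T'1 symT genT; apply/normal_connection_setP; split.
- by rewrite mem_lift_set eqxx !andbF.
- move=> x; rewrite !mem_lift_set !linV invg_eq1 => /orP[/and3P[-> -> ntx] | /symT->].
    by rewrite invg_eq1 ntx.
  by rewrite orbT.
- pose L := <<lift_set eps T>>%G; have /set0Pn[h0 Th0] := nzT.
  have L_T x : lin x \in T -> x \in L by move=> Tx; rewrite mem_gen // mem_lift_set Tx orbT.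
  (* A translation [x] is [g^-1 (g x)] with [g] and [g x] in the same fibre over [h0]. *)
  have L_N x : lin x = 1%g -> x \in L.
    move=> x1; rewrite -(mulKg (affine h0 0%R) x) groupM ?groupV ?L_T //.
    by rewrite linM x1 mulg1.
  (* The linear parts whose whole fibre lies in [L] form a subgroup, and it contains [T]. *)
  have gM : group_set [set h | [forall x : G, (lin x == h) ==> (x \in L)]].
    apply/group_setP; split=> [|h k].
      by rewrite inE; apply/forall_inP=> x /eqP; apply: L_N.
    rewrite !inE => /forall_inP Lh /forall_inP Lk; apply/forall_inP=> x /eqP xhk.
    rewrite -(mulKVg (affine h 0%R) x); apply: groupM; [exact: Lh | apply: Lk].
    by rewrite linM linV xhk lin_affine mulKg.
  apply/setP=> x; rewrite inE; have : <<T>>%g \subset Group gM.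
    rewrite gen_subG; apply/subsetP=> h Th; rewrite inE.
    by apply/forall_inP=> y /eqP yh; rewrite L_T ?yh.
  by rewrite genT => /subsetP/(_ (lin x) (in_setT _)); rewrite inE => /forall_inP->.
move=> x y; rewrite !mem_lift_set => Sx /imsetP[g _ ->].
rewrite (_ : (x ^ g == 1)%g = (x == 1)%g); last exact: conjg_eq1.
suff lin_xg : lin (x ^ g)%g = lin x by rewrite lin_xg.
rewrite /conjg !linM linV [(lin x * _)%g](centsP (unitsT_abelian F)) ?inE //.
by rewrite mulKg.
Qed.

(** The set [N] without 1 and each other fibre of [lin] are single conjugacy classes, so [S]
    contains each of them entirely or not at all. *)
Lemma normal_lift_setP S : normal_connection_set S -> exists eps T,
  [/\ 1%g \notin T, symmetric_set T, <<T>>%g = gU & S = lift_set eps T].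
Proof.
move=> /normal_connection_setP[S'1 symS genS clS].
pose eps := [exists x in S, lin x == 1%g]; pose T := (lin @: S) :\ 1%g.
have defS : S = lift_set eps T.
  apply/setP=> y; rewrite mem_lift_set !inE; have [y1 | nty] := eqVneq (lin y) 1%g.
    rewrite orbF andTb; apply/idP/andP=> [Sy|[/exists_inP[x Sx /eqP x1] nty]].
      by split; [apply/exists_inP; exists y => //; apply/eqP | apply: contraNneq S'1 => <-].
    have ntx : x != 1%g by apply: contraNneq S'1 => <-.
    by apply: clS Sx (conj_translations x1 y1 ntx nty).
  rewrite andbF /=; apply/idP/imsetP=> [Sy | [x Sx xy]]; first by exists y.
  by apply: clS Sx _; apply: conj_lin_neq1; rewrite -?xy.
have T'1 : 1%g \notin T by rewrite !inE eqxx.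
exists eps, T; split=> //.
  move=> h; rewrite !inE invg_eq1 => /andP[-> /imsetP[x Sx ->]].
  by rewrite -linV imset_f ?symS.
have gM : group_set [set x : G | lin x \in <<T>>%g].
  by apply/group_setP; split=> [|x y]; rewrite !inE ?group1 // linM; apply: groupM.
apply/setP=> h; rewrite inE -(lin_affine h 0%R); have : <<S>>%g \subset Group gM.
  rewrite gen_subG; apply/subsetP=> x Sx; rewrite inE.
  have [->|ntx] := eqVneq (lin x) 1%g; first exact: group1.
  by rewrite mem_gen // !inE ntx imset_f.
by rewrite genS => /subsetP/(_ (affine h 0%R) (in_setT _)); rewrite inE.
Qed.

End LiftedSets.

(** * Spectrum of the Cayley graph on a lifted set *)

Section LiftedSpectrum.

Variable F : finFieldType.
Local Notation G := (AGL1 F).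
Local Notation lin := (@linear_part F).
Local Notation gU := [set: {unit F}].
Local Notation chi i := ('chi[gU]_i)%R.

Variables (eps : bool) (T : {set {unit F}}).
Hypotheses (nzT : T != set0) (T'1 : 1%g \notin T) (symT : symmetric_set T).

Local Notation S := (lift_set eps T).
Let abU := unitsT_abelian F.

Local Open Scope ring_scope.

Lemma cayley_lift_sym x y : cayley S x y = cayley S y x.
Proof.
have symS z : z \in S -> z^-1%g \in S.
  rewrite !mem_lift_set linV !invg_eq1 => /orP[->//|/symT->]; exact: orbT.
rewrite /cayley; apply/idP/idP=> /symS; by rewrite invMg invgK.
Qed.

Lemma cayley_liftE x y : (cayley S x y)%:R =
  (if eps then (lin x == lin y)%:R - (x == y)%:R else 0)
    + ((lin x)^-1 * lin y \in T)%g%:R :> algC.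
Proof.
rewrite /cayley mem_lift_set linM linV.
have e1 : (((lin x)^-1 * lin y)%g == 1%g) = (lin x == lin y).
  by rewrite -eq_mulVg1.
have e2 : ((x^-1 * y)%g == 1%g) = (x == y) by rewrite -eq_mulVg1.
rewrite e1 e2; case: eps => /=; last by rewrite add0r.
have [-> | nxy] := eqVneq x y; first by rewrite !eqxx mulVg (negPf T'1) /= subrr add0r.
rewrite subr0 andbT; have [-> | //] := eqVneq (lin x) (lin y).
  by rewrite mulVg (negPf T'1) addr0.
by rewrite add0r.
Qed.

Lemma cayley_lift_sum (f : G -> algC) y :
  \sum_x f x * (cayley S x y)%:R
  = (if eps then (\sum_(x | lin x == lin y) f x) - f y else 0)
    + \sum_(h | (h^-1 * lin y)%g \in T) \sum_(x | lin x == h) f x.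
Proof.
under eq_bigr do rewrite cayley_liftE mulrDr.
rewrite big_split /=; congr (_ + _).
  case: eps; last by rewrite big1 // => x _; rewrite mulr0.
  under eq_bigr do rewrite mulrBr.
  rewrite sumrB; congr (_ - _).
    by rewrite [RHS]big_mkcond; apply: eq_bigr => x _; case: eqP; rewrite ?mulr1 ?mulr0.
  rewrite (bigD1 y) //= eqxx mulr1 big1 ?addr0 // => x /negPf->; exact: mulr0.
rewrite [RHS](exchange_big_dep predT) //=; apply: eq_bigr => x _.
rewrite (eq_bigl (fun h => (h == lin x) && ((lin x)^-1 * lin y \in T)%g)).
  case: (_ \in T); rewrite ?mulr0 ?mulr1; last by rewrite big_pred0 // => h; rewrite andbF.
  by rewrite (eq_bigl _ _ (fun h => andbT _)) big_pred1_eq.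
by move=> h; rewrite eq_sym; case: eqP => [->|]; rewrite ?andbT ?andbF.
Qed.

Lemma sum_lin_fiber (g : {unit F} -> algC) h :
  \sum_(x : G | lin x == h) g (lin x) = #|F|%:R * g h.
Proof.
rewrite (eq_bigr (fun=> g h)) => [|x /eqP-> //].
rewrite sumr_const -(card_lin_fiber h) -[LHS]mulr_natl; congr (_%:R * _).
by apply: eq_card => x; rewrite inE.
Qed.

Lemma cayley_lift_chi i y :
  \sum_x chi i (lin x) * (cayley S x y)%:R = lift_eigenvalue eps T i * chi i (lin y).
Proof.
rewrite cayley_lift_sum sum_lin_fiber.
under eq_bigr do rewrite sum_lin_fiber.
rewrite -mulr_sumr (reindex_inj invg_inj) (reindex_inj (mulgI (lin y)^-1%g)) /=.
have -> : \sum_(h | (((lin y)^-1 * h)^-1^-1 * lin y)%g \in T) chi i ((lin y)^-1 * h)^-1%g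
  = char_sum i T * chi i (lin y).
  rewrite /char_sum mulr_suml (reindex_inj invg_inj) /=.
  apply: eq_big => [h | h _].
    rewrite invgK (centsP abU) ?inE // mulKVg.
    by apply/idP/idP=> /symT; rewrite ?invgK.
  by rewrite invMg !invgK chiM.
rewrite /lift_eigenvalue card_units; case: eps; last by rewrite !add0r; ring.
ring.
Qed.

Lemma eigenvalue_lift i : eigenvalue (adjacency_mx (cayley S)) (lift_eigenvalue eps T i).
Proof.
apply/eigenvalue_adjacency; exists (fun x => chi i (lin x)) => [|y].
  by exists 1%g; rewrite lin1 chi1 // oner_eq0.
exact: cayley_lift_chi.
Qed.

(** An eigenfunction [f] is paired with the eigenfunctions [chi i (lin x)]. By symmetry of the graph
    a nonzero pairing identifies [lam]. If all pairings vanish, Fourier inversion makes every fibre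
    sum of [f] zero, and adjacency acts on [f] as [-1] or [0]. *)
Lemma eigenvalue_lift_inv lam : eigenvalue (adjacency_mx (cayley S)) lam ->
  lam = (if eps then -1 else 0) \/ exists i, lam = lift_eigenvalue eps T i.
Proof.
case/eigenvalue_adjacency=> f [x0 nz_fx0] fA.
pose c i := \sum_x f x * chi i (lin x).
have cE i : lam * c i = lift_eigenvalue eps T i * c i.
  rewrite /c !mulr_sumr.
  transitivity (\sum_y \sum_x f x * (cayley S x y)%:R * chi i (lin y)).
    by apply: eq_bigr => y _; rewrite -mulr_suml fA mulrA.
  rewrite exchange_big /=; apply: eq_bigr => x _.
  rewrite mulrCA -cayley_lift_chi mulr_sumr; apply: eq_bigr => y _.
  by rewrite cayley_lift_sym; ring.
have [i nz_ci | c0] := pickP (fun i => c i != 0).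
  by right; exists i; apply: (mulIf nz_ci).
left; have P0 h : \sum_(x | lin x == h) f x = 0.
  have nzn : (#|{: {unit F}}|%:R : algC) != 0.
    by rewrite pnatr_eq0 -lt0n; apply/card_gt0P; exists 1%g.
  apply: (mulfI nzn); rewrite mulr0.
  transitivity (\sum_i c i * chi i h^-1%g); last first.
    by rewrite big1 // => i _; move/negbFE/eqP: (c0 i) => ->; rewrite mul0r.
  transitivity (\sum_i \sum_x f x * chi i (lin x) * chi i h^-1%g); last first.
    by apply: eq_bigr => i _; rewrite mulr_suml.
  rewrite exchange_big /= big_mkcond mulr_sumr; apply: eq_bigr => x _.
  under eq_bigr do rewrite -mulrA -chiM //.
  rewrite -mulr_sumr sum_chi // -eq_mulgV1.
  by case: eqP => _; rewrite ?mulr0 // mulr1n mulrC.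
have := fA x0; rewrite cayley_lift_sum P0 (big1 _ (fun h => (h^-1 * lin x0)%g \in T)) //.
rewrite addr0 sub0r => E; apply: (mulIf nz_fx0); rewrite -E.
by case: eps; rewrite ?mulN1r ?mul0r.
Qed.

Lemma lift_degree_ge : (#|F| <= lift_degree eps T)%N.
Proof.
rewrite /lift_degree card_units; apply: leq_trans (leq_addl _ _).
by rewrite leq_pmulr // card_gt0.
Qed.

Lemma le_sqrtC (x d : algC) : 1 <= d ->
  (`|x| <= 2 * sqrtC (d - 1)) = (`|x| ^+ 2 <= 4 * (d - 1)).
Proof.
move=> d1; rewrite -[LHS]ler_sqr ?nnegrE //; last by rewrite mulr_ge0 // sqrtC_ge0 subr_ge0.
by rewrite exprMn sqrtCK -natrX.
Qed.

Lemma ramanujan_lift_set : <<T>>%g = gU ->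
  ramanujan (cayley S) <-> lift_ramanujan eps T.
Proof.
move=> genT; have cS : #|S| = lift_degree eps T by rewrite card_lift_set.
have F2 : (1 < #|F|)%N by apply: finNzRing_gt1.
have d1 : 1 <= (lift_degree eps T)%:R :> algC.
  by rewrite (ler_nat _ 1) (leq_trans _ lift_degree_ge) // ltnW.
split=> [[d [_ regS ramS]] i lam d' nlam | ramT].
  rewrite -le_sqrtC //; have -> : d' = d%:R.
    by rewrite /d' -cS -(regS 1%g) regular_cayley.
  by apply: ramS; [apply: eigenvalue_lift | rewrite -(regS 1%g) regular_cayley cS].
exists (lift_degree eps T); split.
- by apply: connected_cayley; have [] := normal_lift_set eps nzT T'1 symT genT.
- by rewrite -cS; apply: regular_cayley.
move=> lam /eigenvalue_lift_inv[-> _ | [i ->] nlam].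
  rewrite le_sqrtC //; case: eps d1 (lift_degree_ge).
    rewrite normrN1 expr1n => d1 dF.
    apply: le_trans (_ : 4 * (2%:R - 1) <= _).
      by apply: (@int_ge0_ler _ _ 3) => //; ring.
    by rewrite ler_wpM2l // lerD2r ler_nat (leq_trans F2).
  by move=> d1 _; rewrite normr0 expr0n /= mulr_ge0 // subr_ge0.
by rewrite le_sqrtC //; apply: ramT.
Qed.

End LiftedSpectrum.

(** * The five types *)

(** Serves to give the types a decidable equality, so that they can be listed and counted. *)
Definition connection_type_code (t : connection_type) : nat :=
  match t with
  | TypeI => 0 | TypeII => 1 | TypeIII => 2 | TypeIV => 3 | TypeV => 4
  end.

Lemma connection_type_code_inj : injective connection_type_code.
Proof. by case=> -[]. Qed.

HB.instance Definition _ :=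
  Equality.copy connection_type (inj_type connection_type_code_inj).

Section Types.

Variable F : finFieldType.
Hypothesis F_ge3 : 3 <= #|F|.

Local Notation G := (AGL1 F).
Local Notation lin := (@linear_part F).
Local Notation gU := [set: {unit F}].

Let abU := unitsT_abelian F.
Let cF := card_units F.
Let cU_gt1 : 1 < #|{: {unit F}}|.
Proof. by rewrite -ltnS -cF. Qed.

Lemma of_typeI S : of_type (F := F) TypeI S = (S == lift_set true [set~ 1%g]).
Proof.
congr (_ == _); apply/setP=> x; rewrite mem_lift_set !inE /=.
by case: (eqVneq x 1%g) => [->|_]; rewrite ?lin1 ?eqxx //; case: eqP.
Qed.

Lemma of_typeII S : of_type (F := F) TypeII S = (S == lift_set false [set~ 1%g]).
Proof.
by congr (_ == _); apply/setP=> x; rewrite mem_lift_set !inE mem_translations andbT.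
Qed.

Lemma of_typeIIIP S : reflect
  (5 <= #|F| /\ exists2 z : {unit F}, #[z]%g = 2 & S = lift_set true (~: [set 1%g; z]))
  (of_type TypeIII S).
Proof.
apply: (iffP andP) => [[F5 /existsP[z /and3P[_ /eqP oz /eqP->]]]|[F5 [z oz ->]]].
  by split=> //; exists z => //; rewrite /lift_set -setTD.
split=> //; apply/existsP; exists z; rewrite (center_idP abU) inE oz eqxx.
by rewrite /lift_set -setTD /=.
Qed.

Lemma index2E (K : {group {unit F}}) :
  (K <| gU)%g && (#|gU : K|%g == 2) = (#|{: {unit F}}| == 2 * #|K|).
Proof.
rewrite -sub_abelian_normal ?subsetT //= -(eqn_pmul2r (cardG_gt0 K)).
by rewrite mulnC Lagrange ?subsetT // cardsT.
Qed.

Lemma of_typeIVP S : reflect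
  (exists2 K : {group {unit F}}, #|{: {unit F}}| = 2 * #|K| & S = lift_set false (~: K))
  (of_type TypeIV S).
Proof.
apply: (iffP existsP) => [[K /and3P[nK iK /eqP->]]|[K cK ->]]; exists K.
  by apply/eqP; rewrite -index2E nK iK.
  by rewrite /lift_set set0U setTD.
by rewrite andbA index2E cK eqxx /lift_set set0U setTD eqxx.
Qed.

Lemma of_typeVP S : reflect
  (7 <= #|F| /\ exists2 K : {group {unit F}}, #|{: {unit F}}| = 2 * #|K| &
     exists z : {unit F}, [/\ z \notin K, #[z]%g = 2 & S = lift_set false (~: K :\ z)])
  (of_type TypeV S).
Proof.
apply: (iffP andP) => [[F7 /existsP[K /existsP[z]]]|[F7 [K cK [z [Kz oz ->]]]]].
  case/and5P=> nK iK; rewrite inE => /andP[Kz _] /eqP oz /eqP->.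
  split=> //; exists K; first by apply/eqP; rewrite -index2E nK iK.
  by exists z; split=> //; rewrite /lift_set set0U setTD.
split=> //; apply/existsP; exists K; apply/existsP; exists z.
rewrite andbA index2E cK eqxx (center_idP abU) !inE Kz oz eqxx /=.
by rewrite /lift_set set0U setTD eqxx.
Qed.

Theorem ramanujan_of_type S : normal_connection_set S -> ramanujan (cayley S) ->
  exists t : connection_type, of_type (F := F) t S.
Proof.
move=> /normal_lift_setP[eps [T [T'1 symT genT ->]]].
have T_gt0 : 0 < #|T|.
  rewrite lt0n cards_eq0; apply: contraTneq cU_gt1 => T0.
  by rewrite -cardsT -genT T0 gen0 cards1.
have nzT : T != set0 by rewrite -card_gt0.
move/(ramanujan_lift_set eps nzT T'1 symT genT); case: eps => ramT.
  have [->|[n4 [z oz ->]]] := full_lift_classification abU (@unit_involution F)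
    cU_gt1 symT T'1 genT ramT.
    by exists TypeI; rewrite of_typeI.
  by exists TypeIII; apply/of_typeIIIP; rewrite cF; split=> //; exists z.
have [->|[K cK [->|[n6 [z [Kz oz ->]]]]]] := nil_lift_classification abU
  (@unit_involution F) symT T'1 genT T_gt0 ramT.
- by exists TypeII; rewrite of_typeII.
- by exists TypeIV; apply/of_typeIVP; exists K.
exists TypeV; apply/of_typeVP; rewrite cF; split=> //.
by exists K => //; exists z.
Qed.

Lemma type_occurs_lift t eps (T : {set {unit F}}) : 0 < #|T| -> 1%g \notin T ->
  symmetric_set T -> <<T>>%g = gU -> lift_ramanujan eps T ->
  of_type t (lift_set eps T) -> type_occurs F t.
Proof.
rewrite card_gt0 => nzT T'1 symT genT ramT tS; exists (lift_set eps T); split=> //.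
  exact: normal_lift_set.
exact/ramanujan_lift_set.
Qed.

Let symmetricC1 : symmetric_set [set~ (1%g : {unit F})].
Proof. by move=> x; rewrite !inE invg_eq1. Qed.

Lemma typeI_occurs : type_occurs F TypeI.
Proof.
apply: (@type_occurs_lift _ true [set~ 1%g]); rewrite ?of_typeI // ?inE ?eqxx //.
- by rewrite cardsC1 -subn1 subn_gt0.
- exact: setC1_gen.
exact: setC1_full_ramanujan.
Qed.

Lemma typeII_occurs : type_occurs F TypeII.
Proof.
apply: (@type_occurs_lift _ false [set~ 1%g]); rewrite ?of_typeII // ?inE ?eqxx //.
- by rewrite cardsC1 -subn1 subn_gt0.
- exact: setC1_gen.
exact: setC1_nil_ramanujan.
Qed.

Lemma typeIII_occurs (z : {unit F}) : 5 <= #|F| -> #[z]%g = 2 -> type_occurs F TypeIII.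
Proof.
move=> F5 oz; have n_gt3 : 3 < #|{: {unit F}}| by rewrite -ltnS -cF.
apply: (@type_occurs_lift _ true (~: [set 1%g; z])).
- by rewrite cardsCs setCK cards2 subn_gt0; case: (_ != _); apply: leq_trans n_gt3.
- by rewrite !inE eqxx.
- move=> x; rewrite !inE invg_eq1; apply: contra => /orP[->//|/eqP xz].
  by rewrite -(invgK x) xz invg2id // eqxx orbT.
- exact: omit_gen.
- exact: omit_full_ramanujan.
by apply/of_typeIIIP; split=> //; exists z.
Qed.

Lemma typeIV_occurs (K : {group {unit F}}) :
  #|{: {unit F}}| = 2 * #|K| -> type_occurs F TypeIV.
Proof.
move=> cK; apply: (@type_occurs_lift _ false (~: K)).
- by rewrite card_index2C ?cardG_gt0.
- by rewrite !inE group1.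
- by move=> x; rewrite !inE groupV.
- exact: index2_gen.
- exact: index2_nil_ramanujan.
by apply/of_typeIVP; exists K.
Qed.

Lemma typeV_occurs (K : {group {unit F}}) (z : {unit F}) : 7 <= #|F| ->
  #|{: {unit F}}| = 2 * #|K| -> z \notin K -> #[z]%g = 2 -> type_occurs F TypeV.
Proof.
move=> F7 cK Kz oz; have K_gt2 : 2 < #|K| by move: F7; rewrite cF cK; lia.
apply: (@type_occurs_lift _ false (~: K :\ z)).
- have := cardsD1 z (~: K); rewrite inE Kz card_index2C // => cKz.
  by move: K_gt2; rewrite cKz; case: #|_|.
- by rewrite !inE group1 andbF.
- by apply: symmetric_setD1; [move=> x; rewrite !inE groupV | rewrite invg2id].
- exact: index2_omit_gen.
- exact: index2_omit_nil_ramanujan.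
by apply/of_typeVP; split=> //; exists K => //; exists z.
Qed.

(** All sets of one type have the same size; these sizes tell the collections [type_sets] apart. *)
Definition type_card (t : connection_type) : nat :=
  match t with
  | TypeI => #|F|.-1 + #|F| * #|F|.-2
  | TypeII => #|F| * #|F|.-2
  | TypeIII => #|F|.-1 + #|F| * (#|F| - 3)
  | TypeIV => #|F| * (#|F|.-1)./2
  | TypeV => #|F| * ((#|F|.-1)./2).-1
  end.

Lemma card_of_type t (S : {set G}) : of_type t S -> #|S| = type_card t.
Proof.
case: t; rewrite /type_card.
- by rewrite of_typeI => /eqP->; rewrite card_lift_set ?inE ?eqxx // /lift_degree cardsC1 -cF cF.
- by rewrite of_typeII => /eqP->; rewrite card_lift_set ?inE ?eqxx // /lift_degree cardsC1 -cF cF.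
- case/of_typeIIIP=> F5 [z oz ->]; rewrite card_lift_set ?inE ?eqxx // /lift_degree.
  by rewrite -cF cardsCs setCK cards2 eq_sym -order_gt1 oz cF /= subSS.
- case/of_typeIVP=> K cK ->; rewrite card_lift_set ?inE ?group1 // /lift_degree.
  by rewrite card_index2C // cF cK add0n /= mul2n doubleK.
case/of_typeVP=> F7 [K cK [z [Kz oz ->]]].
rewrite card_lift_set ?inE ?group1 ?andbF // /lift_degree.
have := cardsD1 z (~: K); rewrite inE Kz card_index2C // => cKz.
by rewrite cF cK add0n /= mul2n doubleK cKz.
Qed.

(** An occurring type has a nonempty collection, so two occurring types with different sizes have
    different collections. *)
Lemma count_types (ts : seq connection_type) : uniq ts -> {in ts &, injective type_card} ->
  (forall t, type_occurs F t <-> t \in ts) -> num_types_occurring F (size ts).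
Proof.
move=> Uts inj_card occ; exists [set C in [seq type_sets F t | t <- ts]].
  move=> C; rewrite inE; split=> [/mapP[t ts_t ->]|[t /occ ts_t ->]].
    by exists t => //; apply/occ.
  exact: map_f.
have inj_ts : {in ts &, injective (type_sets F)}.
  move=> t u ts_t ts_u eq_tu; apply: inj_card => //.
  have [S [_ tS _]] : type_occurs F t by apply/occ.
  rewrite -(card_of_type tS); apply: card_of_type.
  have : S \in type_sets F t by rewrite inE.
  by rewrite eq_tu inE.
by rewrite cardsE (card_uniqP _) ?size_map // map_inj_in_uniq.
Qed.

Lemma involution_dvd (z : {unit F}) : #[z]%g = 2 -> ~~ odd #|{: {unit F}}|.
Proof. by move=> oz; rewrite -dvdn2 -oz -cardsT order_dvdG ?inE. Qed.

(** The unit group has odd order, hence neither an involution nor a subgroup of index two. *)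
Lemma num_types_even : ~~ odd #|F| -> num_types_occurring F 2.
Proof.
rewrite cF /= negbK => oddU; apply: (@count_types [:: TypeI; TypeII]) => // [t u|t].
  rewrite !inE /type_card cF => /orP[]/eqP-> /orP[]/eqP-> //=; lia.
split=> [[S [_ tS _]]|]; last first.
  by rewrite !inE => /orP[]/eqP->; [apply: typeI_occurs | apply: typeII_occurs].
case: t tS => //.
- by case/of_typeIIIP=> _ [z /involution_dvd]; rewrite oddU.
- by case/of_typeIVP=> K cK _; rewrite cK oddM in oddU.
by case/of_typeVP=> _ [K cK _]; rewrite cK oddM in oddU.
Qed.

Lemma exists_involution (K : {group {unit F}}) : ~~ odd #|K| ->
  exists2 z, z \in K & #[z]%g = 2.
Proof. by rewrite -dvdn2 => /Cauchy[]// z Kz oz; exists z. Qed.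

Lemma exists_index2 : odd #|F| ->
  exists K : {group {unit F}}, #|{: {unit F}}| = 2 * #|K|.
Proof.
rewrite cF /= => evenU; have /cyclicP[g genU] := field_unit_group_cyclic [group of gU].
have og : #[g]%g = #|{: {unit F}}| by rewrite orderE -genU cardsT.
exists <[g ^+ 2]>%G; rewrite /= -orderE orderXdiv og ?dvdn2 //.
by rewrite mulnC divnK ?dvdn2.
Qed.

(** At [#|F| = 3] injectivity fails: types II and IV both have size 3. *)
Lemma type_card_inj : odd #|F| -> 5 <= #|F| -> injective type_card.
Proof.
move=> oddF; have [k kE] : exists k, #|F| = (2 * k).+1.
  by exists #|F|./2; rewrite mul2n -[LHS]odd_double_half oddF.
rewrite kE => k_ge2; have : 2 <= k by lia.
case: k {k_ge2} kE => [|[|k]] // kE _ t u; rewrite /type_card kE.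
have -> : ((2 * k.+2).+1.-1)./2 = k.+2 by rewrite -[_.+1.-1]/(2 * k.+2) mul2n doubleK.
by case: t; case: u => //=; nia.
Qed.

Lemma num_types_1mod4 : #|F| = 1 %[mod 4] -> num_types_occurring F 4.
Proof.
move=> F1; have F5 : 5 <= #|F| by lia.
have oddF : odd #|F| by lia.
apply: (@count_types [:: TypeI; TypeII; TypeIII; TypeIV]) => // [t u _ _|t].
  exact: type_card_inj.
have [K cK] := exists_index2 oddF.
have [z _ oz] : exists2 z, z \in gU & #[z]%g = 2.
  by apply: (@exists_involution [group of gU]); rewrite cardsT; move: oddF; rewrite cF.
split=> [[S [_ tS _]]|]; last first.
  rewrite !inE => /or4P[]/eqP->.
  - exact: typeI_occurs.
  - exact: typeII_occurs.
  - exact: typeIII_occurs oz.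
  exact: typeIV_occurs cK.
(* Type V fails: a subgroup of index two has even order, so it contains the unique involution. *)
case: t tS => // /of_typeVP[_ [L cL [y [Ly oy _]]]]; case/negP: Ly.
have [w Lw ow] : exists2 w, w \in L & #[w]%g = 2.
  by apply: exists_involution; move: F1; rewrite cF cL; lia.
by rewrite (unit_involution oy ow).
Qed.

Lemma num_types_3mod4 : #|F| = 3 %[mod 4] -> 7 <= #|F| -> num_types_occurring F 5.
Proof.
move=> F3 F7; have F5 : 5 <= #|F| by apply: leq_trans F7.
have oddF : odd #|F| by lia.
apply: (@count_types [:: TypeI; TypeII; TypeIII; TypeIV; TypeV]) => // [t u _ _|t].
  exact: type_card_inj.
have [K cK] := exists_index2 oddF.
have [z _ oz] : exists2 z, z \in gU & #[z]%g = 2.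
  by apply: (@exists_involution [group of gU]); rewrite cardsT; move: oddF; rewrite cF.
(* Now the subgroup of index two has odd order and cannot contain the involution. *)
have Kz : z \notin K.
  apply/negP=> Kz; have : 2 %| #|K| by rewrite -oz order_dvdG.
  by move: F3; rewrite cF cK; lia.
split=> _; first by case: t.
case: t.
- exact: typeI_occurs.
- exact: typeII_occurs.
- exact: typeIII_occurs oz.
- exact: typeIV_occurs cK.
exact: typeV_occurs cK Kz oz.
Qed.

End Types.

(** * The two graphs for q = 3 and the final statement *)

Lemma cayley_complete (gT : finGroupType) (m : nat) : #|gT| = m ->
  graph_iso (cayley ([set: gT] :\ 1%g)) (@complete_graph m).
Proof.
move=> cm; exists (fun x => cast_ord cm (enum_rank x)).
  apply: (bij_comp (f := cast_ord cm)); last exact: enum_rank_bij.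
  by exists (cast_ord (esym cm)); [apply: cast_ordK | apply: cast_ordKV].
move=> x y; rewrite /complete_graph /cayley (inj_eq (@cast_ord_inj _ _ cm)).
by rewrite (inj_eq enum_rank_inj) !inE andbT -eq_mulVg1.
Qed.

(** The two fibres of [linear_part] are the parts, and [shift] numbers the three vertices of
    each. *)
Lemma cayley_bipartite (F : finFieldType) : #|F| = 3 ->
  graph_iso (cayley ([set: AGL1 F] :\: translations F)) (@complete_bipartite 3 3).
Proof.
move=> F3; have cU : #|{: {unit F}}| = 2 by have := card_units F; rewrite F3 => -[].
have eqU (h k : {unit F}) : h != 1%g -> k != 1%g -> h = k.
  have /card_le1_eqP eqC : #|[set~ (1%g : {unit F})]| <= 1 by rewrite cardsC1 cU.
  by move=> nth ntk; apply: eqC; rewrite !inE.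
have [r r_inj] : exists r : AGL1 F -> 'I_3,
    forall x y, linear_part x = linear_part y -> r x = r y -> x = y.
  exists (fun x => cast_ord F3 (enum_rank (shift x))) => x y eq1.
  by move/cast_ord_inj/enum_rank_inj; apply: affine_inj.
pose h (x : AGL1 F) := if linear_part x == 1%g then inl (r x) else inr (r x) : 'I_3 + 'I_3.
exists h.
  apply: inj_card_bij.
    move=> x y; rewrite /h; case: eqP => [x1|/eqP x1]; case: eqP => [y1|/eqP y1] // [].
      by apply: r_inj; rewrite x1.
    by apply: r_inj; apply: eqU.
  rewrite card_sum card_ord -cardsT.
  have -> : [set: AGL1 F] = @linear_part F @^-1: setT by apply/setP=> x; rewrite !inE.
  by rewrite card_lin_preim cardsT F3 cU.
move=> x y; rewrite /cayley !inE mem_translations andbT linM linV -eq_mulVg1 /h.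
case: eqP => [->|/eqP x1]; case: eqP => [->|/eqP y1] //=.
- by rewrite eqxx.
- by rewrite eq_sym y1.
by rewrite (eqU _ _ x1 y1) eqxx.
Qed.

(** Among three mutually adjacent vertices two would lie in the same part. *)
Lemma complete_not_bipartite :
  ~ graph_iso (@complete_graph 6) (@complete_bipartite 3 3).
Proof.
case=> h _ eh; have adj i j : i != j -> complete_bipartite (h i) (h j).
  by rewrite eh.
have := adj (inord 0) (inord 1); have := adj (inord 0) (inord 2).
have := adj (inord 1) (inord 2); rewrite -!val_eqE /= !inordK //.
case: (h (inord 0)) => a; case: (h (inord 1)) => b; case: (h (inord 2)) => c;
  by move=> // /(_ isT) // _ /(_ isT) // _ /(_ isT).
Qed.

Theorem corollary5p1 (q : nat) (F : finFieldType) (cardF : #|F| = q)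
    (q_ge3 : 3 <= q) :
  [/\ forall S : {set AGL1 F},
        normal_connection_set S -> ramanujan (cayley S) ->
        exists t : connection_type, of_type t S,
      ~~ odd q -> num_types_occurring F 2,
      q = 1 %[mod 4] -> num_types_occurring F 4,
      q = 3 %[mod 4] -> 7 <= q -> num_types_occurring F 5
    & q = 3 ->
        [/\ forall S : {set AGL1 F},
              normal_connection_set S -> ramanujan (cayley S) ->
              graph_iso (cayley S) (@complete_graph 6) \/
              graph_iso (cayley S) (@complete_bipartite 3 3),
            exists S : {set AGL1 F},
              [/\ normal_connection_set S, ramanujan (cayley S)
                & graph_iso (cayley S) (@complete_graph 6)],
            exists S : {set AGL1 F},
              [/\ normal_connection_set S, ramanujan (cayley S)
                & graph_iso (cayley S) (@complete_bipartite 3 3)]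
          & ~ graph_iso (@complete_graph 6) (@complete_bipartite 3 3)]].
Proof.
have F_ge3 : 3 <= #|F| by rewrite cardF.
split.
- exact: ramanujan_of_type.
- by rewrite -cardF; apply: num_types_even.
- by rewrite -cardF; apply: num_types_1mod4.
- by rewrite -cardF; apply: num_types_3mod4.
move=> q3; have F3 : #|F| = 3 by rewrite cardF.
have cU : #|{: {unit F}}| = 2 by have := card_units F; rewrite F3 => -[].
have cG : #|AGL1 F| = 6.
  rewrite -cardsT.
  have -> : [set: AGL1 F] = @linear_part F @^-1: setT by apply/setP=> x; rewrite !inE.
  by rewrite card_lin_preim cardsT F3 cU.
have isoI (S : {set AGL1 F}) : of_type TypeI S -> graph_iso (cayley S) (@complete_graph 6).
  by move/eqP->; apply: cayley_complete.
have isoII (S : {set AGL1 F}) :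
    of_type TypeII S -> graph_iso (cayley S) (@complete_bipartite 3 3).
  by move/eqP->; apply: cayley_bipartite.
split.
- move=> S nS rS; have [[] tS] := ramanujan_of_type F_ge3 nS rS.
  + by left; apply: isoI.
  + by right; apply: isoII.
  + by case/of_typeIIIP: tS; rewrite F3.
  (* The unit group has order 2, so [K] is trivial and the type IV set is the type II set. *)
  + right; apply: isoII; rewrite of_typeII; case/of_typeIVP: tS => K cK ->.
    apply/eqP; congr (lift_set false (~: _)); apply: card1_trivg.
    by apply/eqP; rewrite -(@eqn_pmul2l 2) // -cK cU.
  by case/of_typeVP: tS; rewrite F3.
- have [S [nS tS rS]] := typeI_occurs F_ge3.
  by exists S; split=> //; apply: isoI.
- have [S [nS tS rS]] := typeII_occurs F_ge3.
  by exists S; split=> //; apply: isoII.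
exact: complete_not_bipartite.
Qed.
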